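(* For each integer $k\ge1$ there exists a global bifurcation branch \[ s\mapsto(\phi_k(s),\mu_k(s)),\qquad s>0, \] of nontrivial, $\frac{2\pi}{k}$-periodic, smooth, even solutions to the steady reduced Ostrovsky equation \[ \Big[\tfrac12\phi^2-\mu\phi\Big]_{xx}-\phi=0 \] emerging from the bifurcation point $(0,k^{-2})$. Moreover, given any unbounded sequence $(s_n)_{n\in\mathbb N}$ of positive numbers, there exists a subsequence of $(\phi_k(s_n))_{n\in\mathbb N}$ which converges uniformly to a limiting traveling-wave solution $(\bar\phi_k,\bar\mu_k)$ that solves the steady reduced Ostrovsky equation (with $\phi=\bar\phi_k$, $\mu=\bar\mu_k$) and satisfies \[ \bar\phi_k(0)=\bar\mu_k. \] The limiting wave $\bar\phi_k$ is strictly increasing on $(-\frac{\pi}{k},0)$ and is exactly Lipschitz at every $x\in\frac{2\pi}{k}\mathbb Z$.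
   Context: Let $\mathbb T=[-\pi,\pi]$ with $-\pi$ and $\pi$ identified. Solutions are real-valued, $2\pi$-periodic functions with zero mean, and $\mu>0$ is the wave speed; they correspond to traveling waves $u(t,x)=\phi(x-\mu t)$ of the reduced Ostrovsky equation $[u_t+uu_x]_x-u=0$. A zero-mean function $\phi$ on $\mathbb T$ solves the steady equation if $\int_{-\pi}^{\pi}[\frac12\phi^2-\mu\phi]\psi_{xx}\,dx=\int_{-\pi}^{\pi}\phi\,\psi\,dx$ for all $\psi\in C_c^\infty(-\pi,\pi)$. A branch emerging from $(0,k^{-2})$ is a continuous curve $s\mapsto(\phi_k(s),\mu_k(s))$, $s>0$, in $C^{\alpha}_{0,\mathrm{even}}(\mathbb T)\times(0,\infty)$ ($\alpha\in(1,2)$ fixed; $C^\alpha=C^{1,\alpha-1}$; subscripts denote zero mean and even functions) which converges to $(0,k^{-2})$ as $s\to0^+$. The convergence of the subsequence to $(\bar\phi_k,\bar\mu_k)$ means $\phi_k(s_n)\to\bar\phi_k$ uniformly and $\mu_k(s_n)\to\bar\mu_k$ along the subsequence. $\bar\phi_k$ is exactly Lipschitz at $x_0$ if there are constants $0<c\le C$ and $\delta>0$ with $c|x-x_0|\le|\bar\phi_k(x_0)-\bar\phi_k(x)|\le C|x-x_0|$ for $|x-x_0|<\delta$. *)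

(* Defs.v *)
From Stdlib Require Import Reals.
From Coquelicot Require Import Coquelicot.
Open Scope R_scope.

(* Functions on the circle T = R / 2 pi Z are represented by 2 pi-periodic
   functions on R. *)

Definition periodic (L : R) (f : R -> R) : Prop :=
  forall x, f (x + L) = f x.

Definition even_function (f : R -> R) : Prop :=
  forall x, f (- x) = f x.

(* Riemann integrability on [-pi, pi] is part of this predicate. *)
Definition zero_mean (f : R -> R) : Prop :=
  is_RInt f (- PI) PI 0.

Definition smooth (f : R -> R) : Prop :=
  forall (n : nat) (x : R), ex_derive_n f n x.

Definition test_function (psi : R -> R) : Prop :=
  smooth psi /\
  exists a b : R, - PI < a /\ b < PI /\
    forall x, psi x <> 0 -> a <= x <= b.

(* Since phi is Riemann integrable on [-pi, pi], so are both integrands below: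
   RInt never takes its default value here. *)
Definition steady_solution (phi : R -> R) (mu : R) : Prop :=
  0 < mu /\ periodic (2 * PI) phi /\ zero_mean phi /\
  forall psi : R -> R, test_function psi ->
    RInt (fun x => (/ 2 * phi x ^ 2 - mu * phi x) * Derive_n psi 2 x) (- PI) PI
    = RInt (fun x => phi x * psi x) (- PI) PI.

(* The norm of C^alpha = C^{1, alpha - 1} for 1 < alpha < 2, with value p_infty
   when one of the suprema is infinite.  On 2 pi-periodic functions, the Holder
   quotient over all pairs of distinct reals has the same supremum as the one
   built on the distance of the circle, because the latter distance is attained
   by suitable representatives. *)
Definition holder_norm (alpha : R) (f : R -> R) : Rbar :=
  Rbar_plus
    (Rbar_plus
       (Lub_Rbar (fun r => exists x, r = Rabs (f x)))
       (Lub_Rbar (fun r => exists x, r = Rabs (Derive f x))))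
    (Lub_Rbar (fun r => exists x y, x <> y /\
       r = Rabs (Derive f x - Derive f y) / Rpower (Rabs (x - y)) (alpha - 1))).

(* The space C^alpha_{0,even}(T). *)
Definition holder_0even (alpha : R) (f : R -> R) : Prop :=
  periodic (2 * PI) f /\ even_function f /\ zero_mean f /\
  (forall x, ex_derive f x) /\ Rbar_lt (holder_norm alpha f) p_infty.

Definition holder_converges (alpha : R) (phi : R -> R -> R)
    (F : (R -> Prop) -> Prop) (f : R -> R) : Prop :=
  forall eps : posreal,
    F (fun s => Rbar_lt (holder_norm alpha (fun x => phi s x - f x)) eps).

(* Only the values of phi and mu at s > 0 matter. *)
Definition branch_from_zero (alpha : R) (phi : R -> R -> R) (mu : R -> R)
    (mu0 : R) : Prop :=
  (forall s, 0 < s -> holder_0even alpha (phi s) /\ 0 < mu s) /\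
  (forall s, 0 < s ->
     holder_converges alpha phi (locally s) (phi s) /\ continuous mu s) /\
  holder_converges alpha phi (at_right 0) (fun _ => 0) /\
  filterlim mu (at_right 0) (locally mu0).

Definition exactly_Lipschitz_at (f : R -> R) (x0 : R) : Prop :=
  exists c C delta : R, 0 < c /\ c <= C /\ 0 < delta /\
    forall x, Rabs (x - x0) < delta ->
      c * Rabs (x - x0) <= Rabs (f x0 - f x) <= C * Rabs (x - x0).

(* Convergence in fct_UniformSpace is uniform convergence on R. *)
Definition converges_uniformly (f : nat -> R -> R) (g : R -> R) : Prop :=
  filterlim f eventually (locally (T := fct_UniformSpace R R_UniformSpace) g).

(* Main.v *)
Require Import Defs.
From Stdlib Require Import ZArith Reals Lra Lia ClassicalEpsilon.
From Coquelicot Require Import Coquelicot.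
Open Scope R_scope.

(** The steady equation is integrable, so the whole branch can be written down.
Put w = mu - phi.  Since phi^2/2 - mu phi = (w^2 - mu^2)/2, the equation reads
(w^2/2)'' = mu - w, and multiplying by (w^2/2)' = w w' gives
(w w')^2 = (2/3) (w - w0) (w - w1) (w2 - w), where
w0 + w1 + w2 = 3 mu / 2 and w0 w1 + w0 w2 + w1 w2 = 0.  Up to the scaling
phi(x) -> l^2 phi(x/l), mu -> l^2 mu, the two largest roots may be taken to be
1 - t and 1 + t; the two relations then force w0 = -(1 - t^2)/2 and
mu = 1 + t^2/3.  Writing w = 1 - t cos th turns the first-order equation into
dx/dth = sqrt 3 (1 - t cos th) / sqrt (3 - 2 t cos th - t^2),
which is positive for |t| < 1.  Hence x is a quadrature in th ([position]), th
is its inverse function ([angle]), and rescaling x so that th -> x has degree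
one on the circle gives a 2 pi-periodic even wave [profile t] of speed
[wave_speed t].  Dilating by k gives the waves of period 2 pi / k, and the
branch is s -> t = s/(1+s): t = 0 is the trivial solution, where dx/dth = 1,
and t -> 1 is the end of the branch.

Smoothness: cos, sin, the square root and the reciprocals of the square root
and of 1 - t cos th generate an algebra of functions of th, closed under d/dth,
to which dth/dx belongs; so all derivatives in x of functions of this algebra
are again in it ([trig_algebra_derive], [smooth_of_closed_family]).

Convergence: every limit of profiles, in t -> t0 with |t0| < 1 or in t -> 1, is
an instance of [uniform_of_reparametrization]. If G_t o Y_t = f_t, with f_t ->
f_0 and Y_t -> Y_0 uniformly and G_0 Lipschitz, then G_t -> G_0 uniformly. For
|t0| < 1 this is applied to the profile and its first two derivatives, and a
C^2 bound dominates the norm of C^alpha ([holder_norm_le]). For t -> 1 the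
quadrature degenerates to dx/dth = sqrt 3 |sin (th/2)|, which integrates
explicitly, and the limit is the parabola (|x| - pi)^2/6 - pi^2/18 on [-pi,
pi], with a corner at 0 ([corner_profile]). Its height at 0 is pi^2/9, which is
also the limit of the speed; monotonicity and the exact Lipschitz property are
read off the formula, and the weak equation passes to uniform limits
([steady_solution_limit]). *)

(** * Calculus, smoothness and symmetry *)

Lemma is_derive_zero_eq (f : R -> R) (a b : R) :
  (forall x, is_derive f x 0) -> f a = f b.
Proof.
  intros H.
  destruct (Rtotal_order a b) as [h|[->|h]]; [|easy|symmetry];
    apply (eq_is_derive f); auto.
Qed.

Lemma derivative_bound_Lipschitz (f df : R -> R) (B : R) :
  (forall x, is_derive f x (df x)) -> (forall x, Rabs (df x) <= B) ->
  forall x y, Rabs (f x - f y) <= B * Rabs (x - y).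
Proof.
  intros Hf HB x y.
  destruct (MVT_gen f y x df) as [c [_ Hc]].
  - intros; apply Hf.
  - intros z _. apply continuity_pt_filterlim.
    apply (ex_derive_continuous f). exists (df z); apply Hf.
  - rewrite Hc, Rabs_mult. apply Rmult_le_compat_r; [apply Rabs_pos|apply HB].
Qed.

(** Smoothness of an explicit function without computing its derivatives: by
induction all its iterated derivatives stay in the family. *)
Lemma smooth_of_closed_family (P : (R -> R) -> Prop) :
  (forall f, P f -> exists df, P df /\ forall x, is_derive f x (df x)) ->
  forall f, P f -> smooth f.
Proof.
  intros HP f Hf.
  assert (H : forall n, exists h, P h /\ forall x, Derive_n f n x = h x).
  { induction n as [|n [h [Ph Hh]]].
    - exists f; split; auto.
    - destruct (HP h Ph) as [dh [Pdh Hdh]].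
      exists dh; split; [easy|]. intros x. simpl.
      rewrite (Derive_ext _ h x Hh). apply is_derive_unique, Hdh. }
  intros [|n] x; [exact I|]. simpl.
  destruct (H n) as [h [Ph Hh]]. destruct (HP h Ph) as [dh [_ Hdh]].
  exists (dh x). apply is_derive_ext with (f := h); [intros; symmetry; apply Hh|].
  apply Hdh.
Qed.

(** Everything about an even (or odd) 2 pi-periodic function is decided on
[0, pi]; this is the induction principle that says so. *)
Lemma fold_to_half_period (P : R -> Prop) :
  (forall x, P x <-> P (x + 2 * PI)) ->
  (forall x, P x -> P (- x)) ->
  (forall x, 0 <= x <= PI -> P x) ->
  forall x, P x.
Proof.
  intros Hper Hev H0.
  assert (Hpi := PI_RGT_0).
  assert (Hnat : forall n x, P (x + 2 * PI * INR n) <-> P x).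
  { induction n as [|n IH]; intros x.
    - simpl. replace (x + 2 * PI * 0) with x by ring. tauto.
    - rewrite S_INR.
      replace (x + 2 * PI * (INR n + 1)) with ((x + 2 * PI * INR n) + 2 * PI) by ring.
      rewrite <- Hper. apply IH. }
  assert (H1 : forall x, - PI <= x <= PI -> P x).
  { intros x Hx. destruct (Rle_dec 0 x) as [h|h]; [apply H0; lra|].
    rewrite <- (Ropp_involutive x). apply Hev, H0; lra. }
  assert (H2 : forall x, - PI <= x -> P x).
  { intros x Hx.
    destruct (nfloor_ex ((x + PI) / (2 * PI))) as [n [Hn1 Hn2]].
    { apply Rmult_le_pos; [lra|]. left; apply Rinv_0_lt_compat; lra. }
    replace x with ((x - 2 * PI * INR n) + 2 * PI * INR n) by ring.
    apply Hnat, H1.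
    assert (E : (x + PI) = (x + PI) / (2 * PI) * (2 * PI)) by (field; lra).
    split.
    - assert (INR n * (2 * PI) <= x + PI); [|lra].
      rewrite E. apply Rmult_le_compat_r; lra.
    - assert (x + PI < (INR n + 1) * (2 * PI)); [|lra].
      rewrite E at 1. apply Rmult_lt_compat_r; lra. }
  intros x. destruct (Rle_dec (- PI) x) as [h|h]; [auto|].
  rewrite <- (Ropp_involutive x). apply Hev, H2. lra.
Qed.

(** * Uniform limits of families of functions *)

(** The filter is arbitrary, so that continuity in the parameter, the limit at
the end of the branch and limits of sequences are covered by the same lemmas;
[D] is the half period or the whole line. *)
Definition uniform_limit {T : Type} (D : R -> Prop)
    (F : (T -> Prop) -> Prop) (f : T -> R -> R) (f0 : R -> R) : Prop :=
  forall eps, 0 < eps ->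
    F (fun t => forall x, D x -> Rabs (f t x - f0 x) <= eps).

Definition half_period (th : R) : Prop := 0 <= th <= PI.

Lemma filterlim_Rabs {T} (F : (T -> Prop) -> Prop) {FF : Filter F} (f : T -> R) (l : R) :
  filterlim f F (locally l) <->
  forall eps, 0 < eps -> F (fun t => Rabs (f t - l) <= eps).
Proof.
  split; intros H.
  - intros eps He.
    apply (filter_imp (fun t => ball l eps (f t))).
    + intros t Ht. left. exact Ht.
    + apply (H (ball l eps)). exists (mkposreal eps He). auto.
  - apply filterlim_locally. intros eps.
    apply (filter_imp (fun t => Rabs (f t - l) <= eps / 2)).
    + intros t Ht. change (Rabs (f t - l) < eps).
      assert (h := cond_pos eps). lra.
    + apply H. assert (h := cond_pos eps). lra.
Qed.

Lemma uniform_const {T} D (F : (T -> Prop) -> Prop) {FF : Filter F} (a : T -> R) l :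
  filterlim a F (locally l) -> uniform_limit D F (fun t _ => a t) (fun _ => l).
Proof.
  intros H eps He. generalize (proj1 (filterlim_Rabs F a l) H eps He).
  apply filter_imp. intros t Ht x _. exact Ht.
Qed.

Lemma uniform_at {T} D (F : (T -> Prop) -> Prop) {FF : Filter F} f f0 x :
  uniform_limit D F f f0 -> D x ->
  filterlim (fun t => f t x) F (locally (f0 x)).
Proof.
  intros H Hx. apply filterlim_Rabs; [easy|]. intros eps He.
  generalize (H eps He). apply filter_imp. auto.
Qed.

Lemma uniform_ext {T} D (F : (T -> Prop) -> Prop) {FF : Filter F} f f0 g g0 :
  (forall t x, f t x = g t x) -> (forall x, D x -> f0 x = g0 x) ->
  uniform_limit D F f f0 -> uniform_limit D F g g0.
Proof.
  intros E E0 H eps He. generalize (H eps He). apply filter_imp.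
  intros t Ht x Hx. rewrite <- E, <- E0; auto.
Qed.

Lemma uniform_plus {T} D (F : (T -> Prop) -> Prop) {FF : Filter F} f g f0 g0 :
  uniform_limit D F f f0 -> uniform_limit D F g g0 ->
  uniform_limit D F (fun t x => f t x + g t x) (fun x => f0 x + g0 x).
Proof.
  intros Hf Hg eps He.
  assert (He2 : 0 < eps / 2) by lra.
  generalize (filter_and _ _ (Hf _ He2) (Hg _ He2)). apply filter_imp.
  intros t [H1 H2] x Hx. specialize (H1 x Hx). specialize (H2 x Hx).
  replace (f t x + g t x - (f0 x + g0 x))
    with ((f t x - f0 x) + (g t x - g0 x)) by ring.
  eapply Rle_trans; [apply Rabs_triang|lra].
Qed.

Lemma uniform_mult {T} D (F : (T -> Prop) -> Prop) {FF : Filter F} f g f0 g0 A B :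
  (forall x, D x -> Rabs (f0 x) <= A) -> (forall x, D x -> Rabs (g0 x) <= B) ->
  uniform_limit D F f f0 -> uniform_limit D F g g0 ->
  uniform_limit D F (fun t x => f t x * g t x) (fun x => f0 x * g0 x).
Proof.
  intros HA HB Hf Hg eps He.
  assert (A0 := Rabs_pos A). assert (B0 := Rabs_pos B).
  (* The error of the product is at most [d^2 + |A| d + d |B|], and [d <= 1]. *)
  set (d := Rmin 1 (eps / (Rabs A + Rabs B + 1))).
  assert (Hd : 0 < d).
  { apply Rmin_pos; [lra|]. apply Rdiv_lt_0_compat; lra. }
  assert (Hd1 : d <= 1) by apply Rmin_l.
  assert (Hd2 : d * (Rabs A + Rabs B + 1) <= eps).
  { apply Rle_trans with (eps / (Rabs A + Rabs B + 1) * (Rabs A + Rabs B + 1)).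
    - apply Rmult_le_compat_r; [lra|apply Rmin_r].
    - right; field; lra. }
  generalize (filter_and _ _ (Hf _ Hd) (Hg _ Hd)). apply filter_imp.
  intros t [H1 H2] x Hx. specialize (H1 x Hx). specialize (H2 x Hx).
  assert (a := Rle_trans _ _ _ (HA x Hx) (Rle_abs A)).
  assert (b := Rle_trans _ _ _ (HB x Hx) (Rle_abs B)).
  replace (f t x * g t x - f0 x * g0 x)
    with ((f t x - f0 x) * (g t x - g0 x)
          + (f0 x * (g t x - g0 x) + (f t x - f0 x) * g0 x)) by ring.
  eapply Rle_trans; [apply Rabs_triang|].
  eapply Rle_trans; [apply Rplus_le_compat_l, Rabs_triang|].
  rewrite !Rabs_mult.
  assert (p1 := Rabs_pos (f t x - f0 x)). assert (p2 := Rabs_pos (g t x - g0 x)).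
  assert (p3 := Rabs_pos (f0 x)). assert (p4 := Rabs_pos (g0 x)).
  assert (Rabs (f t x - f0 x) * Rabs (g t x - g0 x) <= d * 1)
    by (apply Rmult_le_compat; lra).
  assert (Rabs (f0 x) * Rabs (g t x - g0 x) <= Rabs A * d)
    by (apply Rmult_le_compat; lra).
  assert (Rabs (f t x - f0 x) * Rabs (g0 x) <= d * Rabs B)
    by (apply Rmult_le_compat; lra).
  lra.
Qed.

Lemma uniform_RInt (F : (R -> Prop) -> Prop) {FF : Filter F} f f0 G G0 :
  F (fun t => forall th, 0 <= th <= PI -> is_RInt (f t) 0 th (G t th)) ->
  (forall th, 0 <= th <= PI -> is_RInt f0 0 th (G0 th)) ->
  uniform_limit half_period F f f0 -> uniform_limit half_period F G G0.
Proof.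
  intros HG HG0 Hf eps He. unfold half_period in *. assert (hpi := PI_RGT_0).
  assert (He' : 0 < eps / PI) by (apply Rdiv_lt_0_compat; lra).
  generalize (filter_and _ _ HG (Hf _ He')). apply filter_imp.
  intros t [H1 H2] th Hth.
  assert (H := is_RInt_minus _ _ _ _ _ _ (H1 th Hth) (HG0 th Hth)).
  apply (norm_RInt_le_const _ _ _ _ (eps / PI)) in H; [|lra|].
  - change (Rabs (G t th - G0 th) <= (th - 0) * (eps / PI)) in H.
    eapply Rle_trans; [exact H|].
    apply Rle_trans with (PI * (eps / PI)); [|right; field; lra].
    apply Rmult_le_compat_r; lra.
  - intros x Hx. apply H2; lra.
Qed.

(** Uniformity in the second variable comes from compactness of the half period. *)
Lemma uniform_of_continuity_2d (f : R -> R -> R) (t0 : R) :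
  (forall th, continuity_2d_pt (fun th t => f t th) th t0) ->
  uniform_limit half_period (locally t0) f (f t0).
Proof.
  intros H eps He. unfold half_period.
  destruct (uniform_continuity_2d_1d (fun th t => f t th) 0 PI t0
              (fun th _ => H th) (mkposreal eps He)) as [d Hd].
  exists d. intros t Ht th Hth. left.
  change (Rabs (t - t0) < d) in Ht. apply Rabs_def2 in Ht.
  apply (Hd th t0 th t); try lra.
  rewrite Rminus_diag, Rabs_R0. apply cond_pos.
Qed.

(** Functions [G t] that are only known through a parametrization, as
[G t (Y t th) = f t th], converge as soon as [f] and [Y] do: for [y = Y t th],
[G t y - G0 y = (f t th - f0 th) + (G0 (Y0 th) - G0 (Y t th))].  The last
difference is controlled by the Lipschitz bound on the limit. *)
Lemma uniform_of_reparametrization (F : (R -> Prop) -> Prop) {FF : Filter F}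
    (f Y G : R -> R -> R) (f0 Y0 G0 : R -> R) (B : R) :
  F (fun t => (forall th, 0 <= th <= PI -> G t (Y t th) = f t th) /\
              (forall y, 0 <= y <= PI -> exists th, 0 <= th <= PI /\ Y t th = y)) ->
  (forall th, 0 <= th <= PI -> 0 <= Y0 th <= PI /\ G0 (Y0 th) = f0 th) ->
  (forall x y, 0 <= x <= PI -> 0 <= y <= PI ->
     Rabs (G0 x - G0 y) <= B * Rabs (x - y)) ->
  uniform_limit half_period F f f0 -> uniform_limit half_period F Y Y0 ->
  uniform_limit half_period F G G0.
Proof.
  intros HF H0 HB Hf HY eps He. unfold half_period in *.
  assert (He2 : 0 < eps / 2) by lra.
  set (B' := Rabs B + 1).
  assert (HB' : 0 < B') by (unfold B'; assert (h := Rabs_pos B); lra).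
  assert (He3 : 0 < eps / (2 * B')) by (apply Rdiv_lt_0_compat; lra).
  generalize (filter_and _ _ HF (filter_and _ _ (Hf _ He2) (HY _ He3))).
  apply filter_imp. intros t [[HG Hsur] [H1 H2]] y Hy.
  destruct (Hsur y Hy) as [th [Hth Eth]].
  destruct (H0 th Hth) as [HY0 HG0].
  specialize (H1 th Hth). specialize (H2 th Hth).
  specialize (HB (Y0 th) y HY0 Hy).
  replace (G t y - G0 y) with ((f t th - f0 th) + (G0 (Y0 th) - G0 y))
    by (rewrite <- HG, Eth, HG0 by easy; ring).
  eapply Rle_trans; [apply Rabs_triang|].
  rewrite Eth, Rabs_minus_sym in H2.
  assert (B * Rabs (Y0 th - y) <= B' * (eps / (2 * B'))).
  { apply Rle_trans with (B' * Rabs (Y0 th - y)).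
    - apply Rmult_le_compat_r; [apply Rabs_pos|].
      unfold B'. assert (h := Rle_abs B). lra.
    - apply Rmult_le_compat_l; lra. }
  replace (B' * (eps / (2 * B'))) with (eps / 2) in H by (field; lra).
  lra.
Qed.

(** * Periodic waves in closed form up to one quadrature *)

(** The quantity [mu - phi], before rescaling, as a function of the angle [th]
that parametrizes the oval of the first integral. *)
Definition depth (t th : R) : R := 1 - t * cos th.

(** Up to the factor [sqrt 2], the square root of [w - w0], where [w0] is
the root of the first integral that the wave does not reach:
[2 w + 1 - t^2 = 3 - 2 t cos th - t^2]. *)
Definition root_factor (t th : R) : R := sqrt (3 - 2 * t * cos th - t ^ 2).
Definition position_rate (t th : R) : R := sqrt 3 * depth t th / root_factor t th.
Definition position (t th : R) : R := RInt (position_rate t) 0 th.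

(** The length scale that turns the half wavelength into [PI]. *)
Definition scale (t : R) : R := PI / position t PI.
Definition phase (t th : R) : R := scale t * position t th.

(** The inverse of [phase t], selected by a choice operator; it is meaningful for
[-1 < t < 1], where [phase t] is a bijection of the line. *)
Definition angle (t y : R) : R :=
  epsilon (inhabits 0) (fun th => phase t th = y).

(** The wave [mu - w] as a function of the angle: the value
[(1 + t^2/3) - (1 - t cos th)] times the square of the length scale. *)
Definition elevation (t th : R) : R := scale t ^ 2 * (t ^ 2 / 3 + t * cos th).
Definition profile (t y : R) : R := elevation t (angle t y).
Definition wave_speed (t : R) : R := scale t ^ 2 * (1 + t ^ 2 / 3).

Lemma sqrt3_pos : 0 < sqrt 3.
Proof. apply sqrt_lt_R0; lra. Qed.

Lemma sqrt3_sqr : sqrt 3 * sqrt 3 = 3.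
Proof. apply sqrt_sqrt; lra. Qed.

Lemma depth_pos t th : -1 < t < 1 -> 0 < depth t th.
Proof.
  intros Ht. unfold depth.
  assert (h := COS_bound th).
  assert (0 <= (1 - t) * (1 + cos th)) by (apply Rmult_le_pos; lra).
  assert (0 <= (1 + t) * (1 - cos th)) by (apply Rmult_le_pos; lra).
  destruct (Rle_dec 0 (cos th)).
  - assert (0 < (1 - t) * (1 + cos th)) by (apply Rmult_lt_0_compat; lra). lra.
  - assert (0 < (1 + t) * (1 - cos th)) by (apply Rmult_lt_0_compat; lra). lra.
Qed.

Lemma radicand_pos t th : -1 < t < 1 -> 0 < 3 - 2 * t * cos th - t ^ 2.
Proof.
  intros Ht. assert (h := depth_pos t th Ht). unfold depth in h.
  assert (0 < 1 - t ^ 2) by nra. lra.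
Qed.

Lemma root_factor_pos t th : -1 < t < 1 -> 0 < root_factor t th.
Proof. intros Ht. apply sqrt_lt_R0, radicand_pos, Ht. Qed.

Lemma root_factor_sqr t th : -1 < t < 1 ->
  root_factor t th * root_factor t th = 3 - 2 * t * cos th - t ^ 2.
Proof. intros Ht. apply sqrt_sqrt. left. apply radicand_pos, Ht. Qed.

Lemma position_rate_pos t th : -1 < t < 1 -> 0 < position_rate t th.
Proof.
  intros Ht. apply Rdiv_lt_0_compat; [|now apply root_factor_pos].
  apply Rmult_lt_0_compat; [apply sqrt3_pos|now apply depth_pos].
Qed.

Lemma cos_periodic th : cos (th + 2 * PI) = cos th.
Proof. now rewrite cos_plus, cos_2PI, sin_2PI, Rmult_1_r, Rmult_0_r, Rminus_0_r. Qed.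

Lemma sin_periodic th : sin (th + 2 * PI) = sin th.
Proof. now rewrite sin_plus, cos_2PI, sin_2PI, Rmult_1_r, Rmult_0_r, Rplus_0_r. Qed.

Lemma depth_periodic t th : depth t (th + 2 * PI) = depth t th.
Proof. unfold depth. now rewrite cos_periodic. Qed.

Lemma root_factor_periodic t th : root_factor t (th + 2 * PI) = root_factor t th.
Proof. unfold root_factor. now rewrite cos_periodic. Qed.

(** * A bounded algebra of functions closed under differentiation *)

(** The reciprocal of the square root is a generator because it appears in the
derivative of the square root. *)
Inductive trig_algebra (t : R) : (R -> R) -> Prop :=
| trig_const c : trig_algebra t (fun _ => c)
| trig_cos : trig_algebra t cos
| trig_sin : trig_algebra t sin
| trig_root : trig_algebra t (root_factor t)
| trig_inv_root : trig_algebra t (fun th => / root_factor t th)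
| trig_inv_depth : trig_algebra t (fun th => / depth t th)
| trig_plus f g : trig_algebra t f -> trig_algebra t g ->
    trig_algebra t (fun th => f th + g th)
| trig_mult f g : trig_algebra t f -> trig_algebra t g ->
    trig_algebra t (fun th => f th * g th).

Ltac in_trig_algebra :=
  repeat first
    [ exact (trig_cos _) | exact (trig_sin _) | exact (trig_root _)
    | exact (trig_inv_root _) | exact (trig_inv_depth _) | exact (trig_const _ _)
    | assumption
    | apply (trig_plus _ (fun th => _) (fun th => _))
    | apply (trig_mult _ (fun th => _) (fun th => _)) ].

Lemma trig_algebra_derive t f : -1 < t < 1 -> trig_algebra t f ->
  exists df, trig_algebra t df /\ forall th, is_derive f th (df th).
Proof.
  intros Ht Hf. induction Hf as [c| | | | | |f g _ [df [Pf Hf]] _ [dg [Pg Hg]]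
    |f g If [df [Pf Hf]] Ig [dg [Pg Hg]]].
  - exists (fun _ => 0); split; [constructor|]. intros; apply (is_derive_const c).
  - exists (fun th => (-1) * sin th); split; [in_trig_algebra|].
    intros. auto_derive; [easy|ring].
  - exists cos; split; [constructor|]. intros. auto_derive; [easy|ring].
  - exists (fun th => t * sin th * / root_factor t th); split; [in_trig_algebra|].
    intros. assert (h := root_factor_pos t th Ht). assert (h' := radicand_pos t th Ht).
    unfold root_factor in *. auto_derive.
    + lra.
    + match goal with |- context [sqrt (?a + ?b + ?c)] =>
        replace (a + b + c) with (3 - 2 * t * cos th - t ^ 2) by ring end.
      field. lra.
  - exists (fun th => (-1) * (t * sin th) * (/ root_factor t th
        * / root_factor t th * / root_factor t th)); split; [in_trig_algebra|].
    intros. assert (h := root_factor_pos t th Ht). assert (h' := radicand_pos t th Ht).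
    unfold root_factor in *. auto_derive.
    + match goal with |- context [sqrt (?a + ?b + ?c)] =>
        replace (a + b + c) with (3 - 2 * t * cos th - t ^ 2) by ring end.
      repeat split; lra.
    + match goal with |- context [sqrt (?a + ?b + ?c)] =>
        replace (a + b + c) with (3 - 2 * t * cos th - t ^ 2) by ring end.
      field. lra.
  - exists (fun th => (-1) * (t * sin th) * (/ depth t th * / depth t th)).
    split; [in_trig_algebra|].
    intros. assert (h := depth_pos t th Ht). unfold depth in *. auto_derive; [lra|].
    field. lra.
  - exists (fun th => df th + dg th); split; [in_trig_algebra|].
    intros. apply (is_derive_plus f g); auto.
  - exists (fun th => df th * g th + f th * dg th); split; [in_trig_algebra|].
    intros. apply (is_derive_mult f g); auto. apply Rmult_comm.
Qed.

(** For [|t| < 1] the two denominators are bounded away from 0, and sums and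
products preserve boundedness.  With [trig_algebra_derive], this makes
every member of the algebra Lipschitz. *)
Lemma trig_algebra_bounded t f : -1 < t < 1 -> trig_algebra t f ->
  exists B, forall th, Rabs (f th) <= B.
Proof.
  intros Ht Hf. induction Hf as [c| | | | | |f g _ [A HA] _ [B HB]
    |f g _ [A HA] _ [B HB]].
  - exists (Rabs c). intros; lra.
  - exists 1. intros; apply Rabs_le, COS_bound.
  - exists 1. intros; apply Rabs_le, SIN_bound.
  - exists (sqrt 6). intros th. rewrite Rabs_pos_eq by apply sqrt_pos.
    apply sqrt_le_1_alt. assert (h := COS_bound th). nra.
  - exists (/ sqrt (1 - t ^ 2)). intros th.
    rewrite Rabs_inv, Rabs_pos_eq by apply sqrt_pos.
    apply Rinv_le_contravar; [apply sqrt_lt_R0; nra|].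
    apply sqrt_le_1_alt. assert (h := depth_pos t th Ht). unfold depth in h. lra.
  - exists (/ (1 - Rabs t)). intros th.
    assert (h : Rabs t < 1) by (apply Rabs_def1; lra).
    rewrite Rabs_inv, Rabs_pos_eq by (left; now apply depth_pos).
    apply Rinv_le_contravar; [lra|]. unfold depth.
    assert (Rabs (t * cos th) <= Rabs t * 1).
    { rewrite Rabs_mult. apply Rmult_le_compat_l; [apply Rabs_pos|].
      apply Rabs_le, COS_bound. }
    assert (h1 := Rle_abs (t * cos th)). lra.
  - exists (A + B). intros th. eapply Rle_trans; [apply Rabs_triang|].
    specialize (HA th); specialize (HB th); lra.
  - exists (A * B). intros th. rewrite Rabs_mult.
    apply Rmult_le_compat; auto using Rabs_pos.
Qed.

(** * The phase and its inverse *)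

Lemma position_rate_continuous t th : -1 < t < 1 -> continuous (position_rate t) th.
Proof.
  intros Ht.
  assert (H : trig_algebra t (fun th =>
    sqrt 3 * (1 + (-1) * (t * cos th)) * / root_factor t th))
    by in_trig_algebra.
  destruct (trig_algebra_derive t _ Ht H) as [d [_ Hd]].
  apply (ex_derive_continuous (position_rate t)). exists (d th).
  apply is_derive_ext with (2 := Hd th). intros x. unfold position_rate, depth. simpl.
  unfold Rdiv. ring.
Qed.

Lemma position_is_RInt t th : -1 < t < 1 -> is_RInt (position_rate t) 0 th (position t th).
Proof.
  intros Ht. apply (RInt_correct (position_rate t)), (ex_RInt_continuous (position_rate t)).
  intros; now apply position_rate_continuous.
Qed.

Lemma position_derive t th : -1 < t < 1 -> is_derive (position t) th (position_rate t th).
Proof.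
  intros Ht. apply (is_derive_RInt (position_rate t) (position t) 0).
  - exists posreal_one. intros y _. now apply position_is_RInt.
  - now apply position_rate_continuous.
Qed.

Lemma position_0 t : position t 0 = 0.
Proof. apply (RInt_point 0 (position_rate t)). Qed.

Lemma position_rate_periodic t th :
  position_rate t (th + 2 * PI) = position_rate t th.
Proof. unfold position_rate. now rewrite depth_periodic, root_factor_periodic. Qed.

Lemma position_rate_even t th : position_rate t (- th) = position_rate t th.
Proof. unfold position_rate, depth, root_factor. now rewrite cos_neg. Qed.

Lemma position_odd t th : -1 < t < 1 -> position t (- th) = - position t th.
Proof.
  intros Ht.
  assert (H := is_derive_zero_eq (fun th => position t (- th) + position t th) th 0).
  simpl in H. rewrite Ropp_0, position_0 in H.
  cut (position t (- th) + position t th = 0 + 0); [lra|]. apply H.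
  intros x.
  replace 0 with ((-1) * position_rate t (- x) + position_rate t x)
    by (rewrite position_rate_even; ring).
  apply (is_derive_plus (fun th => position t (- th)) (position t));
    [|now apply position_derive].
  apply (is_derive_comp (position t) (fun x => - x)); [now apply position_derive|].
  auto_derive; [easy|ring].
Qed.

(** Both sides have the same derivative; the constant is found at [th = - PI],
where oddness gives [position t PI - position t (- PI) = 2 position t PI]. *)
Lemma position_period t th : -1 < t < 1 ->
  position t (th + 2 * PI) = position t th + 2 * position t PI.
Proof.
  intros Ht.
  assert (H : forall a b, position t (a + 2 * PI) - position t a
              = position t (b + 2 * PI) - position t b).
  { intros a b.
    apply (is_derive_zero_eq (fun th => position t (th + 2 * PI) - position t th)).
    intros x.
    replace 0 with (1 * position_rate t (x + 2 * PI) - position_rate t x)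
      by (rewrite position_rate_periodic; ring).
    apply (is_derive_minus (fun th => position t (th + 2 * PI)) (position t));
      [|now apply position_derive].
    apply (is_derive_comp (position t) (fun x => x + 2 * PI)); [now apply position_derive|].
    auto_derive; [easy|ring]. }
  specialize (H th (- PI)). rewrite (position_odd t PI Ht) in H.
  replace (- PI + 2 * PI) with PI in H by ring. lra.
Qed.

Lemma position_increasing t a b : -1 < t < 1 -> a < b -> position t a < position t b.
Proof.
  intros Ht Hab.
  destruct (MVT_gen (position t) a b (position_rate t)) as [c [_ Hc]].
  - intros; now apply position_derive.
  - intros z _. apply continuity_pt_filterlim.
    apply (ex_derive_continuous (position t)). exists (position_rate t z).
    now apply position_derive.
  - assert (h := position_rate_pos t c Ht). nra.
Qed.

Lemma half_period_pos t : -1 < t < 1 -> 0 < position t PI.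
Proof.
  intros Ht. rewrite <- (position_0 t).
  apply position_increasing; [easy|apply PI_RGT_0].
Qed.

Lemma scale_pos t : -1 < t < 1 -> 0 < scale t.
Proof. intros Ht. apply Rdiv_lt_0_compat; [apply PI_RGT_0|now apply half_period_pos]. Qed.

Lemma phase_derive t th : -1 < t < 1 ->
  is_derive (phase t) th (scale t * position_rate t th).
Proof. intros Ht. apply (is_derive_scal (position t)). now apply position_derive. Qed.

Lemma phase_0 t : phase t 0 = 0.
Proof. unfold phase. rewrite position_0. ring. Qed.

Lemma phase_PI t : -1 < t < 1 -> phase t PI = PI.
Proof.
  intros Ht. assert (h := half_period_pos t Ht). unfold phase, scale. field. lra.
Qed.

Lemma phase_odd t th : -1 < t < 1 -> phase t (- th) = - phase t th.
Proof. intros Ht. unfold phase. rewrite position_odd by easy. ring. Qed.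

Lemma phase_period t th : -1 < t < 1 -> phase t (th + 2 * PI) = phase t th + 2 * PI.
Proof.
  intros Ht. rewrite <- (phase_PI t Ht) at 2. unfold phase.
  rewrite position_period by easy. ring.
Qed.

Lemma phase_increasing t a b : -1 < t < 1 -> a < b -> phase t a < phase t b.
Proof.
  intros Ht Hab. apply Rmult_lt_compat_l; [now apply scale_pos|].
  now apply position_increasing.
Qed.

Lemma phase_injective t a b : -1 < t < 1 -> phase t a = phase t b -> a = b.
Proof.
  intros Ht E. destruct (Rtotal_order a b) as [h|[h|h]]; [|easy|];
    apply (phase_increasing t _ _ Ht) in h; lra.
Qed.

Lemma phase_continuity t : -1 < t < 1 -> continuity (phase t).
Proof.
  intros Ht th. apply continuity_pt_filterlim, (ex_derive_continuous (phase t)).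
  eexists. now apply phase_derive.
Qed.

Lemma phase_surjective t y : -1 < t < 1 -> exists th, phase t th = y.
Proof.
  intros Ht. revert y. apply fold_to_half_period.
  - intros y; split; intros [th E].
    + exists (th + 2 * PI). rewrite phase_period, E; easy.
    + exists (th - 2 * PI).
      assert (h := phase_period t (th - 2 * PI) Ht).
      replace (th - 2 * PI + 2 * PI) with th in h by ring. lra.
  - intros y [th E]. exists (- th). rewrite phase_odd, E; easy.
  - intros y Hy. destruct (IVT_gen (phase t) 0 PI y) as [th [_ E]].
    + now apply phase_continuity.
    + rewrite phase_0, phase_PI by easy.
      rewrite Rmin_left, Rmax_right; lra.
    + now exists th.
Qed.

Lemma phase_angle t y : -1 < t < 1 -> phase t (angle t y) = y.
Proof.
  intros Ht. unfold angle.
  apply (epsilon_spec (inhabits 0) (fun th => phase t th = y)).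
  now apply phase_surjective.
Qed.

Lemma angle_phase t th : -1 < t < 1 -> angle t (phase t th) = th.
Proof. intros Ht. apply (phase_injective t); [easy|]. now apply phase_angle. Qed.

Lemma angle_0 t : -1 < t < 1 -> angle t 0 = 0.
Proof. intros Ht. apply (phase_injective t); [easy|]. now rewrite phase_angle, phase_0. Qed.

Lemma angle_odd t y : -1 < t < 1 -> angle t (- y) = - angle t y.
Proof.
  intros Ht. apply (phase_injective t); [easy|].
  now rewrite phase_odd, !phase_angle.
Qed.

Lemma angle_period t y : -1 < t < 1 -> angle t (y + 2 * PI) = angle t y + 2 * PI.
Proof.
  intros Ht. apply (phase_injective t); [easy|].
  now rewrite phase_period, !phase_angle.
Qed.

Lemma angle_half_period t y : -1 < t < 1 -> 0 <= y <= PI -> 0 <= angle t y <= PI.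
Proof.
  intros Ht Hy. assert (E := phase_angle t y Ht). split; apply Rnot_lt_le; intros h;
    apply (phase_increasing t _ _ Ht) in h.
  - rewrite phase_0 in h. lra.
  - rewrite phase_PI in h by easy. lra.
Qed.

Lemma phase_half_period t th : -1 < t < 1 -> 0 <= th <= PI -> 0 <= phase t th <= PI.
Proof.
  intros Ht [[h1|<-] [h2| ->]]; rewrite ?phase_0, ?phase_PI by easy;
    assert (h := PI_RGT_0); try lra.
  apply (phase_increasing t _ _ Ht) in h1. apply (phase_increasing t _ _ Ht) in h2.
  rewrite phase_0 in h1. rewrite phase_PI in h2 by easy. lra.
Qed.

(** The derivative dth/dy of the inverse of the phase, arranged as a member of the
algebra. *)
Definition angle_rate (t th : R) : R :=
  / (scale t * sqrt 3) * (root_factor t th * / depth t th).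

Lemma angle_rate_spec t th : -1 < t < 1 ->
  angle_rate t th = / (scale t * position_rate t th).
Proof.
  intros Ht. unfold angle_rate, position_rate.
  assert (h1 := scale_pos t Ht). assert (h2 := sqrt3_pos).
  assert (h3 := depth_pos t th Ht). assert (h4 := root_factor_pos t th Ht).
  field. repeat split; lra.
Qed.

Lemma angle_rate_trig t : trig_algebra t (angle_rate t).
Proof. unfold angle_rate. in_trig_algebra. Qed.

(** The increments satisfy [h = f (g y + k) - f (g y)] with [k = g (y + h) - g y],
and [k] is nonzero and tends to 0 with [h]; so the difference quotient of [g] is
the reciprocal of one of [f]. *)
Lemma inverse_derive (f g : R -> R) (l : R) (y : R) :
  l <> 0 -> (forall y, f (g y) = y) -> continuous g y -> is_derive f (g y) l ->
  is_derive g y (/ l).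
Proof.
  intros Hl Hfg Hc Hf. apply is_derive_Reals. apply is_derive_Reals in Hf.
  intros eps He.
  assert (L0 : 0 < Rabs l) by now apply Rabs_pos_lt.
  (* With [r = h / k] the difference quotient of [f], if [|r - l| < e] then
     [|r| >= |l|/2], so [|1/r - 1/l| <= 2 e / |l|^2 <= eps / 2]. *)
  set (e := Rmin (Rabs l / 2) (eps * (Rabs l * Rabs l) / 4)).
  assert (e0 : 0 < e).
  { apply Rmin_pos; [lra|]. apply Rmult_lt_0_compat; [|lra].
    repeat apply Rmult_lt_0_compat; lra. }
  destruct (Hf e e0) as [d Hd].
  destruct (proj1 (filterlim_locally g (g y)) Hc d) as [d' Hd'].
  exists d'. intros h h0 Hh.
  assert (E : f (g (y + h)) - f (g y) = h) by (rewrite !Hfg; ring).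
  set (k := g (y + h) - g y).
  assert (k0 : k <> 0).
  { intros k0. replace (g (y + h)) with (g y) in E by (unfold k in k0; lra). lra. }
  assert (Hk : Rabs k < d).
  { apply (Hd' (y + h)). change (Rabs (y + h - y) < d').
    now replace (y + h - y) with h by ring. }
  specialize (Hd k k0 Hk).
  replace (g y + k) with (g (y + h)) in Hd by (unfold k; ring).
  rewrite E in Hd.
  set (r := h / k) in *.
  assert (er1 : e <= Rabs l / 2) by apply Rmin_l.
  assert (er2 : e <= eps * (Rabs l * Rabs l) / 4) by apply Rmin_r.
  assert (r1 : Rabs l / 2 <= Rabs r).
  { assert (Rabs l <= Rabs r + Rabs (r - l)); [|lra].
    replace l with (r - (r - l)) at 1 by ring.
    eapply Rle_trans; [apply Rabs_triang|]. rewrite Rabs_Ropp. lra. }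
  assert (r0 : r <> 0) by (intros ->; rewrite Rabs_R0 in r1; lra).
  replace (k / h - / l) with (- ((r - l) * / (r * l)))
    by (unfold r; field; auto).
  rewrite Rabs_Ropp, Rabs_mult, Rabs_inv, Rabs_mult.
  apply Rle_lt_trans with (e * / (Rabs l / 2 * Rabs l)).
  - apply Rmult_le_compat; [apply Rabs_pos| |lra|].
    + left. apply Rinv_0_lt_compat, Rmult_lt_0_compat; lra.
    + apply Rinv_le_contravar; [apply Rmult_lt_0_compat; lra|].
      apply Rmult_le_compat_r; lra.
  - apply Rle_lt_trans with (eps / 2); [|lra].
    apply Rle_trans with (eps * (Rabs l * Rabs l) / 4 * / (Rabs l / 2 * Rabs l)).
    + apply Rmult_le_compat_r; [|easy].
      left. apply Rinv_0_lt_compat, Rmult_lt_0_compat; lra.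
    + right. field. lra.
Qed.

(** Continuity of the inverse comes from the bound on [angle_rate], that is, from a
positive lower bound for the derivative of [phase]. *)
Lemma angle_derive t y : -1 < t < 1 ->
  is_derive (angle t) y (angle_rate t (angle t y)).
Proof.
  intros Ht. rewrite angle_rate_spec by easy.
  assert (Hpos : forall th, 0 < scale t * position_rate t th)
    by (intros; apply Rmult_lt_0_compat; [now apply scale_pos|now apply position_rate_pos]).
  apply (inverse_derive (phase t)).
  - specialize (Hpos (angle t y)). lra.
  - intros; now apply phase_angle.
  - destruct (trig_algebra_bounded t _ Ht (angle_rate_trig t)) as [B HB].
    assert (HB' : forall x y, Rabs (angle t x - angle t y) <= B * Rabs (x - y)).
    { intros a b.
      destruct (MVT_gen (phase t) (angle t b) (angle t a)
        (fun th => scale t * position_rate t th))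
        as [c [_ Hc]].
      - intros; now apply phase_derive.
      - intros z _. now apply phase_continuity.
      - rewrite !phase_angle in Hc by easy. rewrite Hc.
        specialize (HB c). specialize (Hpos c).
        rewrite angle_rate_spec, Rabs_inv, Rabs_pos_eq in HB by (easy || lra).
        rewrite Rabs_mult, (Rabs_pos_eq (scale t * _)) by lra.
        rewrite <- Rmult_assoc. rewrite <- (Rmult_1_l (Rabs (_ - _))) at 1.
        apply Rmult_le_compat_r; [apply Rabs_pos|].
        apply (Rmult_le_compat_r _ _ _ (Rlt_le _ _ Hpos)) in HB.
        rewrite Rinv_l in HB; lra. }
    assert (B0 : 0 <= B) by (eapply Rle_trans; [apply Rabs_pos|apply (HB 0)]).
    apply filterlim_locally. intros eps.
    assert (d0 : 0 < eps / (B + 1)) by (apply Rdiv_lt_0_compat; [apply cond_pos|lra]).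
    exists (mkposreal _ d0). intros x Hx. change (Rabs (x - y) < eps / (B + 1)) in Hx.
    change (Rabs (angle t x - angle t y) < eps).
    specialize (HB' x y).
    apply (Rmult_lt_compat_r (B + 1)) in Hx; [|lra].
    replace (eps / (B + 1) * (B + 1)) with (pos eps) in Hx by (field; lra).
    assert (h := Rabs_pos (x - y)). lra.
  - now apply phase_derive.
Qed.

(** * The profile solves the equation classically *)

Definition trig_profile (t : R) (f : R -> R) : Prop :=
  exists h, trig_algebra t h /\ forall y, f y = h (angle t y).

Lemma trig_profile_derive t f : -1 < t < 1 -> trig_profile t f ->
  exists df, trig_profile t df /\ forall y, is_derive f y (df y).
Proof.
  intros Ht [h [Hh Ef]]. destruct (trig_algebra_derive t h Ht Hh) as [dh [Pdh Hdh]].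
  exists (fun y => angle_rate t (angle t y) * dh (angle t y)). split.
  - exists (fun th => angle_rate t th * dh th). split; [|easy].
    apply (trig_mult t (angle_rate t) dh); [apply angle_rate_trig|easy].
  - intros y. apply is_derive_ext with (fun y => h (angle t y)); [easy|].
    apply (is_derive_comp h (angle t)); [apply Hdh|]. now apply angle_derive.
Qed.

Lemma trig_profile_bounded t f : -1 < t < 1 -> trig_profile t f ->
  exists B, forall y, Rabs (f y) <= B.
Proof.
  intros Ht [h [Hh Ef]]. destruct (trig_algebra_bounded t h Ht Hh) as [B HB].
  exists B. intros y. now rewrite Ef.
Qed.

Lemma trig_profile_Lipschitz t f : -1 < t < 1 -> trig_profile t f ->
  exists B, forall x y, Rabs (f x - f y) <= B * Rabs (x - y).
Proof.
  intros Ht Hf. destruct (trig_profile_derive t f Ht Hf) as [df [Pdf Hdf]].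
  destruct (trig_profile_bounded t df Ht Pdf) as [B HB].
  exists B. now apply derivative_bound_Lipschitz with df.
Qed.

(** The first derivative of the profile in position, as a function of the angle:
the derivative of [elevation] times [angle_rate]. *)
Definition elevation1 (t th : R) : R :=
  - / sqrt 3 * (scale t * (t * (sin th * (root_factor t th * / depth t th)))).

(** The second derivative of the profile in position, as a function of the angle:
the derivative of [elevation1] times [angle_rate].  The length scale cancels. *)
Definition elevation2 (t th : R) : R :=
  (- / 3 * t) *
  (cos th * (root_factor t th * root_factor t th * (/ depth t th * / depth t th))
   + (t * (sin th * sin th) * (/ depth t th * / depth t th)
      + -1 * (t * (sin th * sin th) * (root_factor t th * root_factor t th)
           * (/ depth t th * (/ depth t th * / depth t th))))).

Lemma elevation_trig t : trig_algebra t (elevation t).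
Proof. unfold elevation. in_trig_algebra. Qed.

Lemma elevation1_trig t : trig_algebra t (elevation1 t).
Proof. unfold elevation1. in_trig_algebra. Qed.

Lemma elevation2_trig t : trig_algebra t (elevation2 t).
Proof. unfold elevation2. in_trig_algebra. Qed.

Definition profile1 (t y : R) : R := elevation1 t (angle t y).
Definition profile2 (t y : R) : R := elevation2 t (angle t y).

Lemma profile_derive t y : -1 < t < 1 -> is_derive (profile t) y (profile1 t y).
Proof.
  intros Ht. unfold profile, profile1.
  assert (h1 := scale_pos t Ht). assert (h2 := sqrt3_pos).
  assert (h3 := depth_pos t (angle t y) Ht).
  replace (elevation1 t (angle t y)) with
    (angle_rate t (angle t y) * (- scale t ^ 2 * t * sin (angle t y)))
    by (unfold elevation1, angle_rate; field; repeat split; lra).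
  apply (is_derive_comp (elevation t) (angle t)); [|now apply angle_derive].
  unfold elevation. auto_derive; [easy|ring].
Qed.

Lemma profile1_derive t y : -1 < t < 1 -> is_derive (profile1 t) y (profile2 t y).
Proof.
  intros Ht. unfold profile1, profile2. set (th := angle t y).
  assert (h1 := scale_pos t Ht). assert (h2 := sqrt3_pos). assert (h2' := sqrt3_sqr).
  assert (h3 := depth_pos t th Ht). assert (h4 := root_factor_pos t th Ht).
  assert (h5 := radicand_pos t th Ht).
  replace (elevation2 t th) with
    (angle_rate t th * (- / sqrt 3 * scale t * t *
      (cos th * root_factor t th / depth t th
       + sin th * (t * sin th / root_factor t th) / depth t th
       - sin th * root_factor t th * (t * sin th) / (depth t th * depth t th)))).
  2:{ unfold elevation2, angle_rate.
      replace (/ 3) with (/ sqrt 3 * / sqrt 3)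
        by (rewrite <- h2' at 3; field; lra).
      field. repeat split; lra. }
  apply (is_derive_comp (elevation1 t) (angle t)); [|now apply angle_derive].
  fold th. unfold elevation1, root_factor, depth in *.
  auto_derive.
  - repeat split; lra.
  - match goal with |- context [sqrt (3 + ?b + ?c)] =>
      replace (3 + b + c) with (3 - 2 * t * cos th - t ^ 2) by ring end.
    field. lra.
Qed.

(** The derivative of [phi^2/2 - mu phi], that is, of half the square of [mu - phi], as
a function of the angle; the factor [depth] cancels in the product. *)
Definition flux1 (t th : R) : R :=
  scale t ^ 3 * t / sqrt 3 * (sin th * root_factor t th).

Lemma flux_derive t y : -1 < t < 1 ->
  is_derive (fun y => / 2 * profile t y ^ 2 - wave_speed t * profile t y) y
    (flux1 t (angle t y)).
Proof.
  intros Ht. assert (H := profile_derive t y Ht).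
  replace (flux1 t (angle t y))
    with ((profile t y - wave_speed t) * profile1 t y).
  - auto_derive; [repeat split; now exists (profile1 t y)|].
    replace (Derive _ _) with (profile1 t y) by (symmetry; apply is_derive_unique, H).
    field.
  - assert (h2 := sqrt3_pos). assert (h3 := depth_pos t (angle t y) Ht).
    unfold profile, wave_speed, profile1, elevation, elevation1, flux1.
    unfold depth in *. field. lra.
Qed.

(** The steady equation itself.  After multiplication by [angle_rate] it reduces to
[cos th (3 - 2 t cos th - t^2) + t sin^2 th = (1 - t cos th) (3 cos th + t)]. *)
Lemma flux1_derive t y : -1 < t < 1 ->
  is_derive (fun y => flux1 t (angle t y)) y (profile t y).
Proof.
  intros Ht. set (th := angle t y).
  assert (h1 := scale_pos t Ht). assert (h2 := sqrt3_pos). assert (h2' := sqrt3_sqr).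
  assert (h3 := depth_pos t th Ht). assert (h4 := root_factor_pos t th Ht).
  assert (h5 := radicand_pos t th Ht). assert (h6 := root_factor_sqr t th Ht).
  assert (h7 := sin2_cos2 th).
  replace (profile t y) with
    (angle_rate t th * (scale t ^ 3 * t / sqrt 3 *
      (cos th * root_factor t th + sin th * (t * sin th / root_factor t th)))).
  2:{ unfold profile, elevation. fold th. unfold angle_rate.
      transitivity (scale t ^ 2 * t / (sqrt 3 * sqrt 3) *
        ((cos th * (root_factor t th * root_factor t th) + t * (Rsqr (sin th))) / depth t th)).
      - unfold Rsqr. field. repeat split; lra.
      - rewrite h2', h6. replace (Rsqr (sin th)) with (1 - Rsqr (cos th)) by lra.
        unfold Rsqr, depth in *. field. lra. }
  apply (is_derive_comp (flux1 t) (angle t)); [|now apply angle_derive].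
  fold th. unfold flux1, root_factor in *.
  auto_derive.
  - repeat split; lra.
  - match goal with |- context [sqrt (3 + ?b + ?c)] =>
      replace (3 + b + c) with (3 - 2 * t * cos th - t ^ 2) by ring end.
    field. lra.
Qed.

(** * Uniform convergence of scale, phase and elevation *)

Lemma filterlim_Rmult {T} (F : (T -> Prop) -> Prop) {FF : Filter F} f g a b :
  filterlim f F (locally a) -> filterlim g F (locally b) ->
  filterlim (fun t => f t * g t) F (locally (a * b)).
Proof.
  intros Hf Hg. eapply filterlim_comp_2; [exact Hf|exact Hg|].
  apply (filterlim_mult a b).
Qed.

Lemma filterlim_Rplus {T} (F : (T -> Prop) -> Prop) {FF : Filter F} f g a b :
  filterlim f F (locally a) -> filterlim g F (locally b) ->
  filterlim (fun t => f t + g t) F (locally (a + b)).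
Proof.
  intros Hf Hg. eapply filterlim_comp_2; [exact Hf|exact Hg|].
  apply (filterlim_plus a b).
Qed.

Lemma scale_limit (F : (R -> Prop) -> Prop) {FF : Filter F} P0 :
  uniform_limit half_period F position P0 -> P0 PI <> 0 ->
  filterlim scale F (locally (PI / P0 PI)).
Proof.
  intros H H0. apply filterlim_Rmult; [easy|apply filterlim_const|].
  apply (filterlim_comp _ _ _ (fun t => position t PI) Rinv F (locally (P0 PI))).
  - apply (uniform_at half_period); [easy|easy|]. unfold half_period.
    assert (h := PI_RGT_0). lra.
  - apply (continuous_Rinv (P0 PI) H0).
Qed.

Lemma phase_uniform (F : (R -> Prop) -> Prop) {FF : Filter F} P0 A :
  uniform_limit half_period F position P0 -> P0 PI <> 0 ->
  (forall th, half_period th -> Rabs (P0 th) <= A) ->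
  uniform_limit half_period F phase (fun th => PI / P0 PI * P0 th).
Proof.
  intros H H0 HA.
  apply (uniform_mult half_period F (fun t _ => scale t) position (fun _ => PI / P0 PI) P0
           (Rabs (PI / P0 PI)) A); auto.
  - intros; lra.
  - apply uniform_const; [easy|]. now apply scale_limit.
Qed.

Lemma wave_speed_limit (F : (R -> Prop) -> Prop) {FF : Filter F} l t0 :
  filterlim (fun t => t) F (locally t0) -> filterlim scale F (locally l) ->
  filterlim wave_speed F (locally (l ^ 2 * (1 + t0 ^ 2 / 3))).
Proof.
  intros Ht Hs. unfold wave_speed. simpl.
  repeat first [ assumption | apply filterlim_const | apply filterlim_Rplus
               | apply filterlim_Rmult ]; easy.
Qed.

Lemma elevation_uniform (F : (R -> Prop) -> Prop) {FF : Filter F} l t0 :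
  filterlim (fun t => t) F (locally t0) -> filterlim scale F (locally l) ->
  uniform_limit half_period F elevation
    (fun th => l ^ 2 * (t0 ^ 2 / 3 + t0 * cos th)).
Proof.
  intros Ht Hs.
  assert (Hcos : forall th, Rabs (cos th) <= 1) by (intros; apply Rabs_le, COS_bound).
  apply (uniform_mult half_period F (fun t _ => scale t ^ 2)
           (fun t th => t ^ 2 / 3 + t * cos th) (fun _ => l ^ 2)
           (fun th => t0 ^ 2 / 3 + t0 * cos th) (l ^ 2) (t0 ^ 2 / 3 + Rabs t0)).
  - intros. rewrite Rabs_pos_eq; [lra|apply pow2_ge_0].
  - intros th _. eapply Rle_trans; [apply Rabs_triang|].
    rewrite Rabs_mult, (Rabs_pos_eq (t0 ^ 2 / 3)).
    + assert (h := Rabs_pos t0). specialize (Hcos th). nra.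
    + assert (h := pow2_ge_0 t0). lra.
  - apply uniform_const; [easy|]. simpl.
    repeat first [ assumption | apply filterlim_const | apply filterlim_Rmult ]; easy.
  - apply uniform_plus; [easy| |].
    + apply (uniform_const half_period F (fun t => t ^ 2 / 3)). simpl.
      repeat first [ assumption | apply filterlim_const | apply filterlim_Rmult ]; easy.
    + apply (uniform_mult half_period F (fun t _ => t) (fun _ th => cos th) (fun _ => t0)
           (fun th => cos th) (Rabs t0) 1); auto.
      * intros; lra.
      * now apply uniform_const.
      * intros eps He. apply filter_forall. intros t th _.
        rewrite Rminus_diag, Rabs_R0. lra.
Qed.

(** * Continuous dependence on the amplitude *)

Lemma depth_continuity_2d th t0 :
  continuity_2d_pt (fun th t => depth t th) th t0.
Proof.
  unfold depth.
  apply (continuity_2d_pt_minus (fun _ _ => 1) (fun th t => t * cos th)).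
  - apply continuity_2d_pt_const.
  - apply (continuity_2d_pt_mult (fun _ t => t) (fun th _ => cos th)).
    + apply continuity_2d_pt_id2.
    + apply (continuity_1d_2d_pt_comp cos (fun th _ => th)).
      * apply continuity_cos.
      * apply continuity_2d_pt_id1.
Qed.

Lemma inv_depth_continuity_2d th t0 : -1 < t0 < 1 ->
  continuity_2d_pt (fun th t => / depth t th) th t0.
Proof.
  intros Ht. apply (continuity_2d_pt_inv (fun th t => depth t th)).
  - apply depth_continuity_2d.
  - assert (h := depth_pos t0 th Ht). lra.
Qed.

Lemma root_factor_continuity_2d th t0 : -1 < t0 < 1 ->
  continuity_2d_pt (fun th t => root_factor t th) th t0.
Proof.
  intros Ht. unfold root_factor.
  apply (continuity_1d_2d_pt_comp sqrt (fun th t => 3 - 2 * t * cos th - t ^ 2)).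
  - apply continuity_pt_sqrt. left. now apply radicand_pos.
  - apply continuity_2d_pt_ext with (fun th t => (2 * depth t th + 1) - t * t).
    { intros; unfold depth; ring. }
    apply (continuity_2d_pt_minus (fun th t => 2 * depth t th + 1) (fun th t => t * t)).
    + apply (continuity_2d_pt_plus (fun th t => 2 * depth t th) (fun th t => 1));
        [|apply continuity_2d_pt_const].
      apply (continuity_2d_pt_mult (fun _ _ => 2) (fun th t => depth t th));
        [apply continuity_2d_pt_const|apply depth_continuity_2d].
    + apply (continuity_2d_pt_mult (fun _ t => t) (fun _ t => t));
        apply continuity_2d_pt_id2.
Qed.

Ltac continuity_2d :=
  repeat first
    [ apply continuity_2d_pt_const | apply continuity_2d_pt_id2
    | exact (continuity_1d_2d_pt_comp cos (fun th _ => th) _ _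
        (continuity_cos _) (continuity_2d_pt_id1 _ _))
    | exact (continuity_1d_2d_pt_comp sin (fun th _ => th) _ _
        (continuity_sin _) (continuity_2d_pt_id1 _ _))
    | apply depth_continuity_2d
    | apply inv_depth_continuity_2d; assumption
    | apply root_factor_continuity_2d; assumption
    | apply (continuity_2d_pt_plus (fun _ _ => _) (fun _ _ => _))
    | apply (continuity_2d_pt_mult (fun _ _ => _) (fun _ _ => _)) ].

Lemma position_rate_uniform t0 : -1 < t0 < 1 ->
  uniform_limit half_period (locally t0) position_rate (position_rate t0).
Proof.
  intros Ht. apply uniform_of_continuity_2d. intros th. unfold position_rate, Rdiv.
  apply (continuity_2d_pt_mult (fun th t => sqrt 3 * depth t th)
           (fun th t => / root_factor t th)).
  - continuity_2d.
  - apply (continuity_2d_pt_inv (fun th t => root_factor t th)); [continuity_2d|].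
    assert (h := root_factor_pos t0 th Ht). lra.
Qed.

Lemma locally_interior t0 : -1 < t0 < 1 -> locally t0 (fun t => -1 < t < 1).
Proof.
  intros Ht.
  assert (d0 : 0 < Rmin (t0 + 1) (1 - t0)) by (apply Rmin_pos; lra).
  exists (mkposreal _ d0). intros t H.
  change (Rabs (t - t0) < Rmin (t0 + 1) (1 - t0)) in H.
  assert (h1 := Rmin_l (t0 + 1) (1 - t0)). assert (h2 := Rmin_r (t0 + 1) (1 - t0)).
  apply Rabs_def2 in H. lra.
Qed.

Lemma position_uniform t0 : -1 < t0 < 1 ->
  uniform_limit half_period (locally t0) position (position t0).
Proof.
  intros Ht. apply (uniform_RInt _ position_rate (position_rate t0)).
  - generalize (locally_interior t0 Ht). apply filter_imp.
    intros; now apply position_is_RInt.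
  - intros; now apply position_is_RInt.
  - now apply position_rate_uniform.
Qed.

Lemma scale_continuous t0 : -1 < t0 < 1 -> filterlim scale (locally t0) (locally (scale t0)).
Proof.
  intros Ht. apply (scale_limit (locally t0) (position t0)).
  - now apply position_uniform.
  - assert (h := half_period_pos t0 Ht). lra.
Qed.

Lemma phase_uniform_interior t0 : -1 < t0 < 1 ->
  uniform_limit half_period (locally t0) phase (phase t0).
Proof.
  intros Ht. assert (h := half_period_pos t0 Ht).
  apply (phase_uniform (locally t0) (position t0) (position t0 PI)).
  - now apply position_uniform.
  - lra.
  - intros th [[h1|<-] [h2| ->]]; rewrite ?position_0, ?Rabs_R0; try lra.
    + apply (position_increasing t0 _ _ Ht) in h1. apply (position_increasing t0 _ _ Ht) in h2.
      rewrite position_0 in h1. rewrite Rabs_pos_eq; lra.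
    + rewrite Rabs_pos_eq; lra.
    + rewrite Rabs_pos_eq; lra.
Qed.

Lemma elevation1_uniform t0 : -1 < t0 < 1 ->
  uniform_limit half_period (locally t0) elevation1 (elevation1 t0).
Proof.
  intros Ht.
  set (e := fun t th : R => t * (sin th * (root_factor t th * / depth t th))).
  destruct (trig_algebra_bounded t0 (e t0) Ht) as [B HB]; [unfold e; in_trig_algebra|].
  apply uniform_ext with (fun t th => (- / sqrt 3 * scale t) * e t th)
    (fun th => (- / sqrt 3 * scale t0) * e t0 th); [|unfold elevation1, e; intros; ring..|].
  { apply locally_filter. }
  apply (uniform_mult half_period (locally t0) (fun t _ => - / sqrt 3 * scale t) e
    (fun _ => - / sqrt 3 * scale t0) (e t0) (Rabs (- / sqrt 3 * scale t0)) B).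
  - intros; lra.
  - auto.
  - apply uniform_const; [apply locally_filter|].
    apply filterlim_Rmult; [apply locally_filter|apply filterlim_const|].
    now apply scale_continuous.
  - apply uniform_of_continuity_2d. intros th. unfold e. continuity_2d.
Qed.

Lemma elevation2_uniform t0 : -1 < t0 < 1 ->
  uniform_limit half_period (locally t0) elevation2 (elevation2 t0).
Proof.
  intros Ht. apply uniform_of_continuity_2d. intros th. unfold elevation2. continuity_2d.
Qed.

(** The sign [c] treats even ([c = 1]) and odd ([c = -1]) families together. *)
Lemma uniform_on_line_of_half_period {T} (F : (T -> Prop) -> Prop) {FF : Filter F} G G0 c :
  c * c = 1 ->
  F (fun t => (forall y, G t (y + 2 * PI) = G t y) /\ (forall y, G t (- y) = c * G t y)) ->
  (forall y, G0 (y + 2 * PI) = G0 y) -> (forall y, G0 (- y) = c * G0 y) ->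
  uniform_limit half_period F G G0 -> uniform_limit (fun _ => True) F G G0.
Proof.
  intros Hc HG Hper Hev H eps He.
  assert (Hc' : Rabs c = 1) by (unfold Rabs; destruct (Rcase_abs c); nra).
  generalize (filter_and _ _ HG (H eps He)). apply filter_imp.
  intros t [[H1 H2] H3] x _. revert x. apply fold_to_half_period.
  - intros x. rewrite H1, Hper. tauto.
  - intros x Hx. rewrite H2, Hev, <- Rmult_minus_distr_l, Rabs_mult, Hc'. lra.
  - exact H3.
Qed.

(** Applied to the profile and to its first two derivatives, this is the continuity
of the branch in C^2. *)
Lemma travelling_family_uniform (f : R -> R -> R) (c t0 : R) :
  -1 < t0 < 1 -> c * c = 1 ->
  (forall t, trig_algebra t (f t)) ->
  (forall t th, f t (th + 2 * PI) = f t th) ->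
  (forall t th, f t (- th) = c * f t th) ->
  uniform_limit half_period (locally t0) f (f t0) ->
  uniform_limit (fun _ => True) (locally t0)
    (fun t y => f t (angle t y)) (fun y => f t0 (angle t0 y)).
Proof.
  intros Ht Hc Htrig Hper Hpar Hunif.
  apply (uniform_on_line_of_half_period _ _ _ c Hc).
  - generalize (locally_interior t0 Ht). apply filter_imp. intros t Ht'.
    split; intros y; [rewrite angle_period|rewrite angle_odd]; auto.
  - intros y; rewrite angle_period; auto.
  - intros y; rewrite angle_odd; auto.
  - destruct (trig_profile_Lipschitz t0 (fun y => f t0 (angle t0 y)) Ht) as [B HB].
    { exists (f t0); auto. }
    apply (uniform_of_reparametrization _ f phase _ (f t0) (phase t0) _ B).
    + generalize (locally_interior t0 Ht). apply filter_imp. intros t Ht'. split.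
      * intros th _. now rewrite angle_phase.
      * intros y Hy. exists (angle t y). split; [now apply angle_half_period|].
        now apply phase_angle.
    + intros th Hth. split; [now apply phase_half_period|]. now rewrite angle_phase.
    + auto.
    + exact Hunif.
    + now apply phase_uniform_interior.
Qed.

Lemma profile_uniform t0 : -1 < t0 < 1 ->
  uniform_limit (fun _ => True) (locally t0) profile (profile t0).
Proof.
  intros Ht. apply (travelling_family_uniform elevation 1 t0 Ht);
    [ring|apply elevation_trig|..].
  - intros. unfold elevation. now rewrite cos_periodic.
  - intros. unfold elevation. rewrite cos_neg. ring.
  - apply elevation_uniform; [apply locally_filter|apply filterlim_id|].
    now apply scale_continuous.
Qed.

Lemma profile1_uniform t0 : -1 < t0 < 1 ->
  uniform_limit (fun _ => True) (locally t0) profile1 (profile1 t0).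
Proof.
  intros Ht. apply (travelling_family_uniform elevation1 (-1) t0 Ht);
    [ring|apply elevation1_trig|..].
  - intros. unfold elevation1. now rewrite root_factor_periodic, depth_periodic, sin_periodic.
  - intros. unfold elevation1, root_factor, depth. rewrite cos_neg, sin_neg. ring.
  - now apply elevation1_uniform.
Qed.

Lemma profile2_uniform t0 : -1 < t0 < 1 ->
  uniform_limit (fun _ => True) (locally t0) profile2 (profile2 t0).
Proof.
  intros Ht. apply (travelling_family_uniform elevation2 1 t0 Ht);
    [ring|apply elevation2_trig|..].
  - intros. unfold elevation2.
    now rewrite root_factor_periodic, depth_periodic, sin_periodic, cos_periodic.
  - intros. unfold elevation2, root_factor, depth. rewrite cos_neg, sin_neg. ring.
  - now apply elevation2_uniform.
Qed.

(** * The limit of amplitude one *)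

(** The function [acos (cos y)] is the distance from [y] to the nearest multiple of
[2 PI], so this is the parabola [(|y| - PI)^2 / 6 - PI^2 / 18] on
the interval from [- PI] to [PI], continued periodically. *)
Definition corner_profile (y : R) : R := (acos (cos y) - PI) ^ 2 / 6 - PI ^ 2 / 18.

(** With [q = root_factor t th] and [p = 1 - t^2] one has [position_rate t th =
(sqrt 3 / 2) (q - p / q)]. Since [q^2 >= p], the quotient [p / q] is at most
[sqrt p]; and [q^2] differs from [(2 sin (th/2))^2] by at most [4 (1 - t)], so
that [q] differs from [2 sin (th/2)] by at most [2 sqrt (1 - t)]. Both bounds
are uniform in [th], although [position_rate] becomes 0/0 at [t = 1], [th = 0]. *)
Lemma position_rate_uniform_1 :
  uniform_limit half_period (at_left 1) position_rate (fun th => sqrt 3 * sin (th / 2)).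
Proof.
  (* Here [d] plays the role of [sqrt (1 - t)]. *)
  intros eps He. unfold half_period. set (d := eps / 4).
  assert (d0 : 0 < d) by (unfold d; lra).
  assert (r0 : 0 < Rmin 1 (d * d)) by (apply Rmin_pos; [lra|now apply Rmult_lt_0_compat]).
  exists (mkposreal _ r0). intros t Hb Hlt th Hth.
  change (Rabs (t - 1) < Rmin 1 (d * d)) in Hb. apply Rabs_def2 in Hb.
  assert (m1 := Rmin_l 1 (d * d)). assert (m2 := Rmin_r 1 (d * d)).
  assert (Ht : -1 < t < 1) by lra. assert (Hd : 1 - t <= d * d) by lra.
  assert (q0 := root_factor_pos t th Ht). assert (qq := root_factor_sqr t th Ht).
  unfold position_rate. set (q := root_factor t th) in *.
  set (z := 2 * sin (th / 2)).
  assert (z0 : 0 <= z).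
  { assert (0 <= sin (th / 2)); [|unfold z; lra].
    apply sin_ge_0; lra. }
  assert (zz : z * z = 2 - 2 * cos th).
  { replace th with (2 * (th / 2)) at 1 by field. rewrite cos_2a_sin. unfold z. ring. }
  assert (hc := COS_bound th).
  assert (Hqz : q * q - z * z = (1 - t) * (2 * cos th + 1 + t)) by (rewrite qq, zz; ring).
  assert (Hqz1 : q * q - z * z <= 4 * (d * d)) by nra.
  assert (Hqz2 : - (4 * (d * d)) <= q * q - z * z) by nra.
  set (p := 1 - t ^ 2).
  assert (p0 : 0 <= p) by (unfold p; nra).
  assert (p2 : p <= 2 * (d * d)) by (unfold p; nra).
  assert (hp : p <= q * q) by (rewrite qq; unfold p; nra).
  assert (Hp : p / q <= 2 * d).
  { apply (Rmult_le_reg_r q); [easy|]. replace (p / q * q) with p by (field; lra).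
    apply Rsqr_incr_0_var; [|apply Rmult_le_pos; lra]. unfold Rsqr.
    apply Rle_trans with (2 * (d * d) * (q * q)); [|nra].
    apply Rmult_le_compat; lra. }
  assert (Hp' : 0 <= p / q) by (apply Rdiv_le_0_compat; lra).
  assert (H1 : q - z <= 2 * d) by (apply Rnot_lt_le; intros h; nra).
  assert (H2 : z - q <= 2 * d) by (apply Rnot_lt_le; intros h; nra).
  replace (sqrt 3 * depth t th / q - sqrt 3 * sin (th / 2))
    with (sqrt 3 / 2 * (q - z - p / q)).
  2:{ replace (depth t th) with ((q * q - p) / 2)
        by (rewrite qq; unfold depth, p; field).
      unfold z. field. lra. }
  assert (s3 := sqrt3_pos). assert (s3' := sqrt3_sqr).
  rewrite Rabs_mult, Rabs_pos_eq by lra.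
  assert (sqrt 3 <= 2) by nra.
  assert (Rabs (q - z - p / q) <= 4 * d) by (apply Rabs_le; lra).
  replace eps with (1 * (4 * d)) by (unfold d; field).
  apply Rmult_le_compat; [lra|apply Rabs_pos|lra|lra].
Qed.

Definition corner_position (th : R) : R := 2 * sqrt 3 * (1 - cos (th / 2)).

Lemma corner_position_is_RInt th :
  is_RInt (fun th => sqrt 3 * sin (th / 2)) 0 th (corner_position th).
Proof.
  replace (corner_position th) with (minus (corner_position th) (corner_position 0)).
  2:{ unfold corner_position, minus, plus, opp; simpl.
      replace (0 / 2) with 0 by field. rewrite cos_0. ring. }
  apply (is_RInt_derive corner_position).
  - intros x _. unfold corner_position. auto_derive; [easy|]. unfold Rdiv. field.
  - intros x _. apply (ex_derive_continuous (fun th => sqrt 3 * sin (th / 2))).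
    auto_derive. easy.
Qed.

Lemma at_left_interior : at_left 1 (fun t => -1 < t < 1).
Proof.
  exists (mkposreal 1 Rlt_0_1). intros t H Hlt. change (Rabs (t - 1) < 1) in H.
  apply Rabs_def2 in H. lra.
Qed.

Lemma position_uniform_1 : uniform_limit half_period (at_left 1) position corner_position.
Proof.
  apply (uniform_RInt _ position_rate (fun th => sqrt 3 * sin (th / 2))).
  - generalize at_left_interior. apply filter_imp. intros; now apply position_is_RInt.
  - intros; apply corner_position_is_RInt.
  - apply position_rate_uniform_1.
Qed.

Lemma corner_position_PI : corner_position PI = 2 * sqrt 3.
Proof. unfold corner_position. rewrite cos_PI2. ring. Qed.

Lemma scale_limit_1 : filterlim scale (at_left 1) (locally (PI / (2 * sqrt 3))).
Proof.
  rewrite <- corner_position_PI. apply (scale_limit (at_left 1)); [apply position_uniform_1|].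
  rewrite corner_position_PI. assert (h := sqrt3_pos). lra.
Qed.

Lemma corner_scale_sqr : (PI / (2 * sqrt 3)) ^ 2 = PI ^ 2 / 12.
Proof.
  assert (h := sqrt3_pos). assert (h' := sqrt3_sqr).
  replace 12 with (4 * (sqrt 3 * sqrt 3)) by (rewrite h'; ring). field. lra.
Qed.

Lemma filterlim_id_at_left : filterlim (fun t : R => t) (at_left 1) (locally 1).
Proof. intros P H; now apply filter_le_within. Qed.

Lemma wave_speed_limit_1 : filterlim wave_speed (at_left 1) (locally (PI ^ 2 / 9)).
Proof.
  replace (PI ^ 2 / 9) with ((PI / (2 * sqrt 3)) ^ 2 * (1 + 1 ^ 2 / 3))
    by (rewrite corner_scale_sqr; field).
  apply (wave_speed_limit (at_left 1)); [apply filterlim_id_at_left|apply scale_limit_1].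
Qed.

Lemma corner_profile_even y : corner_profile (- y) = corner_profile y.
Proof. unfold corner_profile. now rewrite cos_neg. Qed.

Lemma corner_profile_periodic y : corner_profile (y + 2 * PI) = corner_profile y.
Proof. unfold corner_profile. now rewrite cos_periodic. Qed.

Lemma corner_profile_half_period y : 0 <= y <= PI ->
  corner_profile y = (PI - y) ^ 2 / 6 - PI ^ 2 / 18.
Proof. intros Hy. unfold corner_profile. rewrite acos_cos by easy. field. Qed.

(** For the limiting phase [Y0 th = PI (1 - cos (th/2))], the parabola at [Y0 th] is
[PI^2 cos^2 (th/2) / 6 - PI^2 / 18], which is the limiting elevation. *)
Lemma profile_uniform_1 :
  uniform_limit (fun _ => True) (at_left 1) profile corner_profile.
Proof.
  assert (hpi := PI_RGT_0). assert (h3 := sqrt3_pos).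
  apply (uniform_on_line_of_half_period _ _ _ 1).
  - ring.
  - generalize at_left_interior. apply filter_imp. intros t Ht. unfold profile, elevation.
    split; intros y; [rewrite angle_period, cos_periodic|rewrite angle_odd, cos_neg];
      easy || ring.
  - apply corner_profile_periodic.
  - intros y. rewrite corner_profile_even. ring.
  - apply (uniform_of_reparametrization _ elevation phase _
      (fun th => PI ^ 2 / 12 * (/ 3 + cos th)) (fun th => PI * (1 - cos (th / 2))) _ (PI / 3)).
    + generalize at_left_interior. apply filter_imp. intros t Ht. split.
      * intros th _. unfold profile. now rewrite angle_phase.
      * intros y Hy. exists (angle t y). split; [now apply angle_half_period|].
        now apply phase_angle.
    + intros th Hth.
      assert (h := COS_bound (th / 2)).
      assert (h' : 0 <= cos (th / 2)) by (apply cos_ge_0; lra).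
      assert (Hy : 0 <= PI * (1 - cos (th / 2)) <= PI) by nra.
      split; [easy|]. rewrite corner_profile_half_period by easy.
      replace th with (2 * (th / 2)) at 2 by field. rewrite cos_2a_cos. field.
    + intros x y Hx Hy. rewrite !corner_profile_half_period by easy.
      replace ((PI - x) ^ 2 / 6 - PI ^ 2 / 18 - ((PI - y) ^ 2 / 6 - PI ^ 2 / 18))
        with ((x + y - 2 * PI) / 6 * (x - y)) by field.
      rewrite Rabs_mult. apply Rmult_le_compat_r; [apply Rabs_pos|].
      apply Rabs_le. lra.
    + assert (H := elevation_uniform (at_left 1) _ 1 filterlim_id_at_left scale_limit_1).
      rewrite corner_scale_sqr in H.
      apply (uniform_ext _ _ _ _ _ _ (fun _ _ => eq_refl)) with (2 := H).
      intros. field.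
    + assert (H := phase_uniform (at_left 1) corner_position (2 * (2 * sqrt 3))
                    position_uniform_1).
      rewrite corner_position_PI in H.
      apply (uniform_ext _ _ phase _ phase _ (fun _ _ => eq_refl)) with (2 := H ltac:(lra)
        ltac:(intros th _; unfold corner_position; assert (h := COS_bound (th / 2));
              rewrite Rabs_pos_eq; nra)).
      intros. unfold corner_position. field. lra.
Qed.

(** * The Holder norm and a C^2 bound *)

(** The Holder quotient of the derivative is at most [2 A] for points at distance at
least 1, and, by the mean value theorem, at most [A |x - y|^(2 - alpha) <= A] for
closer points. *)
Lemma holder_norm_le (alpha : R) (f f1 f2 : R -> R) (A : R) :
  1 < alpha < 2 ->
  (forall x, is_derive f x (f1 x)) -> (forall x, is_derive f1 x (f2 x)) ->
  (forall x, Rabs (f x) <= A) -> (forall x, Rabs (f1 x) <= A) ->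
  (forall x, Rabs (f2 x) <= A) ->
  Rbar_le (holder_norm alpha f) (4 * A).
Proof.
  intros Ha H1 H2 B0 B1 B2.
  assert (A0 : 0 <= A) by (eapply Rle_trans; [apply Rabs_pos|apply (B0 0)]).
  assert (E : forall x, Derive f x = f1 x) by (intros; apply is_derive_unique, H1).
  assert (Hlub : forall (S : R -> Prop) b, (forall r, S r -> r <= b) ->
            Rbar_le (Lub_Rbar S) b).
  { intros S b HS. apply (proj2 (Lub_Rbar_correct S)). exact HS. }
  replace (Finite (4 * A)) with (Rbar_plus (Rbar_plus A A) (2 * A))
    by (simpl; f_equal; ring).
  apply Rbar_plus_le_compat; [apply Rbar_plus_le_compat|]; apply Hlub.
  - intros r [x ->]. apply B0.
  - intros r [x ->]. rewrite E. apply B1.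
  - intros r [x [y [Hxy ->]]]. rewrite !E.
    assert (d0 : 0 < Rabs (x - y)) by (apply Rabs_pos_lt; lra).
    set (d := Rabs (x - y)) in *.
    assert (p0 : 0 < Rpower d (alpha - 1)) by apply exp_pos.
    apply (Rmult_le_reg_r _ _ _ p0). unfold Rdiv.
    rewrite Rmult_assoc, Rinv_l, Rmult_1_r by lra.
    destruct (Rle_dec 1 d) as [h|h].
    + apply Rle_trans with (2 * A * 1).
      * replace (f1 x - f1 y) with (f1 x + - f1 y) by ring.
        eapply Rle_trans; [apply Rabs_triang|]. rewrite Rabs_Ropp.
        assert (b1 := B1 x). assert (b2 := B1 y). lra.
      * apply Rmult_le_compat_l; [lra|].
        assert (Hp : Rpower d 0 <= Rpower d (alpha - 1)) by (apply Rle_Rpower; lra).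
        rewrite Rpower_O in Hp; lra.
    + apply Rle_trans with (A * d); [exact (derivative_bound_Lipschitz f1 f2 A H2 B2 x y)|].
      apply Rmult_le_compat; try lra.
      (* For [0 < d < 1], [Rpower d] is nonincreasing and [alpha - 1 <= 1]. *)
      rewrite <- (Rpower_1 d d0) at 1. unfold Rpower.
      assert (ln d <= 0) by (rewrite <- ln_1; apply ln_le; lra).
      destruct (Req_dec (1 * ln d) ((alpha - 1) * ln d)) as [e|e]; [rewrite e; lra|].
      left. apply exp_increasing. nra.
Qed.

(** * Classical solutions, and uniform limits of solutions *)

Lemma periodic_mult (L : R) (f : R -> R) (n : nat) : periodic L f -> periodic (INR n * L) f.
Proof.
  intros H. induction n as [|n IH]; intros x.
  - simpl. f_equal. ring.
  - rewrite S_INR. replace (x + (INR n + 1) * L) with ((x + INR n * L) + L) by ring.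
    rewrite H. apply IH.
Qed.

(** A test function vanishes near and beyond the ends of the period, so the boundary
terms of the integrations by parts are zero. *)
Lemma test_function_vanishes psi n x : test_function psi ->
  x <= - PI \/ PI <= x -> Derive_n psi n x = 0.
Proof.
  intros [_ [a [b [Ha [Hb Hs]]]]] Hx.
  assert (Hloc : locally x (fun y => psi y = 0)).
  { assert (H0 : forall y, y < a \/ b < y -> psi y = 0).
    { intros y Hy. destruct (Req_dec (psi y) 0) as [e|e]; [easy|].
      specialize (Hs y e). lra. }
    destruct Hx as [Hx|Hx].
    - apply filter_imp with (fun y => y < a); [auto|]. apply open_lt. lra.
    - apply filter_imp with (fun y => b < y); [auto|]. apply open_gt. lra. }
  rewrite (Derive_n_ext_loc psi (fun _ => 0) n x Hloc).
  destruct n as [|n]; [easy|]. apply Derive_n_const.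
Qed.

Lemma test_function_bounded psi n : test_function psi ->
  exists B, forall x, Rabs (Derive_n psi n x) <= B.
Proof.
  intros Hpsi. assert (hpi := PI_RGT_0).
  destruct (bounded_continuity (Derive_n psi n) (- PI) PI) as [B HB].
  - intros x _. apply (ex_derive_continuous (Derive_n psi n)).
    apply (proj1 Hpsi (S n) x).
  - exists B. intros x.
    destruct (Rle_dec x (- PI)) as [h|h]; [|destruct (Rle_dec PI x) as [h'|h']].
    + rewrite test_function_vanishes, Rabs_R0 by auto.
      eapply Rle_trans; [apply (Rabs_pos (Derive_n psi n 0))|]. left. apply (HB 0). lra.
    + rewrite test_function_vanishes, Rabs_R0 by auto.
      eapply Rle_trans; [apply (Rabs_pos (Derive_n psi n 0))|]. left. apply (HB 0). lra.
    + left. apply HB. lra.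
Qed.

Lemma test_function_Derive_n_continuous psi n x : test_function psi ->
  continuous (Derive_n psi n) x.
Proof. intros [H _]. apply (ex_derive_continuous (Derive_n psi n)), (H (S n) x). Qed.

Lemma test_function_derive psi n x : test_function psi ->
  is_derive (Derive_n psi n) x (Derive_n psi (S n) x).
Proof. intros [H _]. apply Derive_correct, (H (S n) x). Qed.

(** Both integrations by parts at once: with [V = u^2/2 - mu u], [V' = du] and
[V'' = u], the derivative of [V psi' - V' psi] is [V psi'' - u psi].  The mean of
[u] is zero because [u] is the derivative of the periodic function [du]. *)
Lemma classical_solution_steady (u du : R -> R) (mu : R) :
  0 < mu -> periodic (2 * PI) u -> periodic (2 * PI) du ->
  (forall x, continuous u x) ->
  (forall x, is_derive (fun x => / 2 * u x ^ 2 - mu * u x) x (du x)) ->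
  (forall x, is_derive du x (u x)) ->
  steady_solution u mu.
Proof.
  intros Hmu Pu Pdu Hc H1 H2. split; [easy|]. split; [easy|]. split.
  - unfold zero_mean. replace 0 with (minus (du PI) (du (- PI))).
    + apply (is_RInt_derive du); intros; [apply H2|apply Hc].
    + replace PI with (- PI + 2 * PI) at 1 by ring. rewrite Pdu. apply Rminus_diag.
  - intros psi Hpsi. set (V := fun x => / 2 * u x ^ 2 - mu * u x).
    change (RInt (fun x => V x * Derive_n psi 2 x) (- PI) PI
            = RInt (fun x => u x * psi x) (- PI) PI).
    assert (cV : forall x, continuous V x)
      by (intros x; apply (ex_derive_continuous V); exists (du x); apply H1).
    assert (I1 : forall x, continuous (fun x => V x * Derive_n psi 2 x) x).
    { intros x. apply (continuous_mult V (Derive_n psi 2)); [apply cV|].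
      now apply test_function_Derive_n_continuous. }
    assert (I2 : forall x, continuous (fun x => u x * psi x) x).
    { intros x. apply (continuous_mult u psi); [apply Hc|].
      now apply (test_function_Derive_n_continuous psi 0). }
    set (W := fun x => V x * Derive_n psi 1 x - du x * Derive_n psi 0 x).
    assert (HW : is_RInt (fun x => V x * Derive_n psi 2 x - u x * psi x) (- PI) PI
                   (minus (W PI) (W (- PI)))).
    { apply (is_RInt_derive W).
      - intros x _.
        replace (V x * Derive_n psi 2 x - u x * psi x) with
          ((du x * Derive_n psi 1 x + V x * Derive_n psi 2 x)
           - (u x * Derive_n psi 0 x + du x * Derive_n psi 1 x)) by (simpl; ring).
        apply (is_derive_minus (fun x => V x * Derive_n psi 1 x)
                               (fun x => du x * Derive_n psi 0 x)).
        + apply (is_derive_mult V (Derive_n psi 1)); [apply H1| |apply Rmult_comm].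
          now apply test_function_derive.
        + apply (is_derive_mult du (Derive_n psi 0)); [apply H2| |apply Rmult_comm].
          now apply test_function_derive.
      - intros x _. apply (continuous_minus (fun x => V x * Derive_n psi 2 x)
          (fun x => u x * psi x)); auto. }
    assert (E := RInt_minus (fun x => V x * Derive_n psi 2 x) (fun x => u x * psi x)
                   (- PI) PI).
    assert (E' : RInt (fun x => V x * Derive_n psi 2 x - u x * psi x) (- PI) PI = 0).
    { rewrite (is_RInt_unique (V := R_CompleteNormedModule) _ _ _ _ HW). unfold W.
      rewrite !(test_function_vanishes psi _ PI), !(test_function_vanishes psi _ (- PI))
        by first [easy | left; lra | right; lra].
      unfold minus, plus, opp. simpl. ring. }
    unfold minus, plus, opp in E. simpl in E. simpl in E' |- *.
    apply Rminus_diag_uniq.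
    etransitivity; [symmetry; apply E|exact E'].
    + apply (ex_RInt_continuous (fun x => V x * Derive_n psi 2 x)). intros; apply I1.
    + apply (ex_RInt_continuous (fun x => u x * psi x)). intros; apply I2.
Qed.

Lemma converges_uniformly_iff (f : nat -> R -> R) (g : R -> R) :
  uniform_limit (fun _ => True) eventually f g -> converges_uniformly f g.
Proof.
  intros H. apply filterlim_locally. intros eps.
  assert (h := cond_pos eps).
  generalize (H (eps / 2) ltac:(lra)). apply filter_imp.
  intros n Hn x. change (Rabs (f n x - g x) < eps). specialize (Hn x I). lra.
Qed.

Lemma is_RInt_uniform_limit (f : nat -> R -> R) (g : R -> R) (a b : R) :
  (forall n x, continuous (f n) x) ->
  uniform_limit (fun _ => True) eventually f g ->
  is_lim_seq (fun n => RInt (f n) a b) (RInt g a b) /\ ex_RInt g a b.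
Proof.
  intros Hc H.
  destruct (filterlim_RInt f a b eventually _ g (fun n => RInt (f n) a b)) as [l [Hl Hg]].
  - intros n. apply (RInt_correct (f n)), (ex_RInt_continuous (f n)). intros; apply Hc.
  - now apply converges_uniformly_iff.
  - rewrite (is_RInt_unique _ _ _ _ Hg). split; [exact Hl|now exists l].
Qed.

(** The weak formulation has no derivative on the unknown, so it passes to uniform
limits; the limit is allowed to have corners. *)
Lemma steady_solution_limit (u : nat -> R -> R) (v : R -> R) (mu : nat -> R) (m B : R) :
  (forall n, steady_solution (u n) (mu n)) -> (forall n x, continuous (u n) x) ->
  uniform_limit (fun _ => True) eventually u v -> is_lim_seq mu m ->
  0 < m -> (forall x, Rabs (v x) <= B) -> steady_solution v m.
Proof.
  intros Hu Hc Huv Hmu Hm HB. split; [easy|]. split; [|split].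
  - intros x.
    assert (E1 := uniform_at _ eventually u v (x + 2 * PI) Huv I).
    assert (E2 := uniform_at _ eventually u v x Huv I).
    apply (filterlim_locally_unique (F := eventually) (fun n => u n x)); [|exact E2].
    apply filterlim_ext with (2 := E1). intros n. apply Hu.
  - destruct (is_RInt_uniform_limit u v (- PI) PI Hc Huv) as [Hl Hex].
    unfold zero_mean. replace 0 with (RInt v (- PI) PI).
    + now apply (RInt_correct v).
    + apply (filterlim_locally_unique (F := eventually) (fun n => RInt (u n) (- PI) PI));
        [exact Hl|].
      apply filterlim_ext with (fun _ => 0); [|apply filterlim_const].
      intros n. symmetry. apply is_RInt_unique, Hu.
  - intros psi Hpsi.
    destruct (test_function_bounded psi 2 Hpsi) as [C2 HC2].
    destruct (test_function_bounded psi 0 Hpsi) as [C0 HC0].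
    assert (Hmu' : uniform_limit (fun _ => True) eventually
              (fun n _ => - mu n) (fun _ => - m)).
    { apply (uniform_const (fun _ => True) eventually (fun n => - mu n)).
      apply (filterlim_comp _ _ _ mu Ropp _ (locally m)); [exact Hmu|].
      apply (filterlim_opp m). }
    assert (Hid : forall h : R -> R, 
      uniform_limit (fun _ => True) eventually (fun (_ : nat) x => h x) h).
    { intros h eps He. apply filter_forall. intros n x _. rewrite Rminus_diag, Rabs_R0. lra. }
    assert (HV : uniform_limit (fun _ => True) eventually
       (fun n x => (/ 2 * u n x ^ 2 - mu n * u n x) * Derive_n psi 2 x)
       (fun x => (/ 2 * v x ^ 2 - m * v x) * Derive_n psi 2 x)).
    { apply uniform_ext with (fun n x => (u n x * (/ 2 * u n x + - mu n)) * Derive_n psi 2 x)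
        (fun x => (v x * (/ 2 * v x + - m)) * Derive_n psi 2 x);
        [apply eventually_filter|intros; ring..|].
      assert (HB2 : forall x, Rabs (/ 2 * v x + - m) <= / 2 * B + m).
      { intros x. eapply Rle_trans; [apply Rabs_triang|].
        rewrite Rabs_mult, Rabs_Ropp, (Rabs_pos_eq m), (Rabs_pos_eq (/ 2)) by lra.
        specialize (HB x). lra. }
      assert (B0 : 0 <= B) by (eapply Rle_trans; [apply Rabs_pos|apply (HB 0)]).
      assert (HW : uniform_limit (fun _ => True) eventually
         (fun n x => / 2 * u n x + - mu n) (fun x => / 2 * v x + - m)).
      { apply (uniform_plus _ eventually (fun n x => / 2 * u n x) (fun n x => - mu n)
                 (fun x => / 2 * v x) (fun x => - m)); [|exact Hmu'].
        apply (uniform_mult _ eventually (fun n x => / 2) u (fun _ => / 2) v (/ 2) B); auto.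
        intros; rewrite Rabs_pos_eq; lra. }
      apply (uniform_mult _ eventually (fun n x => u n x * (/ 2 * u n x + - mu n))
        (fun n x => Derive_n psi 2 x) (fun x => v x * (/ 2 * v x + - m)) (Derive_n psi 2)
        (B * (/ 2 * B + m)) C2); auto.
      - intros x _. rewrite Rabs_mult. apply Rmult_le_compat; auto using Rabs_pos.
      - apply (uniform_mult _ eventually u (fun n x => / 2 * u n x + - mu n) v _ B
          (/ 2 * B + m)); auto. }
    assert (HR : uniform_limit (fun _ => True) eventually
       (fun n x => u n x * psi x) (fun x => v x * psi x))
      by (apply (uniform_mult _ eventually u (fun n x => psi x) v psi B C0); auto).
    assert (cV : forall n x, continuous
              (fun x => (/ 2 * u n x ^ 2 - mu n * u n x) * Derive_n psi 2 x) x).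
    { intros n x.
      apply (continuous_mult (fun x => / 2 * u n x ^ 2 - mu n * u n x) (Derive_n psi 2));
        [|now apply test_function_Derive_n_continuous].
      apply (continuous_minus (fun x => / 2 * u n x ^ 2) (fun x => mu n * u n x)).
      - apply (continuous_mult (fun _ => / 2) (fun x => u n x ^ 2)); [apply continuous_const|].
        apply (continuous_mult (u n) (fun x => u n x * 1)); [apply Hc|].
        apply (continuous_mult (u n) (fun _ => 1)); [apply Hc|apply continuous_const].
      - apply (continuous_mult (fun _ => mu n) (u n)); [apply continuous_const|apply Hc]. }
    assert (cR : forall n x, continuous (fun x => u n x * psi x) x).
    { intros n x. apply (continuous_mult (u n) psi); [apply Hc|].
      now apply (test_function_Derive_n_continuous psi 0). }
    destruct (is_RInt_uniform_limit _ _ (- PI) PI cV HV) as [L1 _].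
    destruct (is_RInt_uniform_limit _ _ (- PI) PI cR HR) as [L2 _].
    apply (filterlim_locally_unique (F := eventually)
             (fun n => RInt (fun x => u n x * psi x) (- PI) PI)); [|exact L2].
    apply filterlim_ext with (2 := L1). intros n.
    destruct (Hu n) as [_ [_ [_ Hw]]]. now apply Hw.
Qed.

(** * The branch *)

(** Maps [0 < s] onto [0 < t < 1]: the bifurcation point corresponds to [t = 0] and
the end of the branch to [t = 1]. *)
Definition amplitude (s : R) : R := s / (1 + s).
Definition branch (k : nat) (s x : R) : R :=
  / INR k ^ 2 * profile (amplitude s) (INR k * x).
Definition branch_speed (k : nat) (s : R) : R := / INR k ^ 2 * wave_speed (amplitude s).
Definition corner_wave (k : nat) (x : R) : R := / INR k ^ 2 * corner_profile (INR k * x).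

Lemma amplitude_bounds s : 0 < s -> 0 < amplitude s < 1.
Proof.
  intros Hs. unfold amplitude. split; [apply Rdiv_lt_0_compat; lra|].
  apply (Rmult_lt_reg_r (1 + s)); [lra|]. unfold Rdiv.
  rewrite Rmult_assoc, Rinv_l; lra.
Qed.

Lemma amplitude_continuous s : 0 <= s ->
  filterlim amplitude (locally s) (locally (amplitude s)).
Proof.
  intros Hs. apply (ex_derive_continuous amplitude). unfold amplitude. auto_derive. lra.
Qed.

Lemma amplitude_at_right_0 : filterlim amplitude (at_right 0) (locally 0).
Proof.
  replace (locally 0) with (locally (amplitude 0)) by (f_equal; unfold amplitude; field).
  intros P HP. apply filter_le_within. apply (amplitude_continuous 0 (Rle_refl 0) P HP).
Qed.

Lemma amplitude_at_infinity : filterlim amplitude (Rbar_locally p_infty) (at_left 1).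
Proof.
  intros P [eps HP]. assert (h := cond_pos eps).
  exists (/ eps). intros s Hs.
  assert (e0 := Rinv_0_lt_compat _ h).
  assert (Ha := amplitude_bounds s ltac:(lra)).
  apply HP; [|lra]. change (Rabs (amplitude s - 1) < eps).
  rewrite Rabs_minus_sym, Rabs_pos_eq by lra.
  replace (1 - amplitude s) with (/ (1 + s)) by (unfold amplitude; field; lra).
  rewrite <- (Rinv_inv eps). apply Rinv_lt_contravar; [|lra].
  apply Rmult_lt_0_compat; lra.
Qed.

Lemma INR_ge_1 k : (1 <= k)%nat -> 1 <= INR k.
Proof. intros H. apply (le_INR 1) in H. exact H. Qed.

Lemma inv_pow_le_1 K n : 1 <= K -> 0 < / K ^ n <= 1.
Proof.
  intros HK. assert (h := pow_R1_Rle K n HK). split.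
  - apply Rinv_0_lt_compat. lra.
  - rewrite <- Rinv_1. apply Rinv_le_contravar; lra.
Qed.

Lemma derive_dilation (f : R -> R) (l c K x : R) :
  is_derive f (K * x) l -> is_derive (fun x => c * f (K * x)) x (c * (K * l)).
Proof.
  intros H. apply (is_derive_scal (fun x => f (K * x))).
  apply (is_derive_comp f (fun x => K * x)); [exact H|].
  auto_derive; [easy|ring].
Qed.

Lemma dilated_profile_derive k t x : (1 <= k)%nat -> -1 < t < 1 ->
  is_derive (fun x => / INR k ^ 2 * profile t (INR k * x)) x
    (/ INR k * profile1 t (INR k * x)).
Proof.
  intros Hk Ht. assert (HK := INR_ge_1 k Hk).
  replace (/ INR k * _) with (/ INR k ^ 2 * (INR k * profile1 t (INR k * x)))
    by (field; lra).
  now apply derive_dilation, profile_derive.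
Qed.

Lemma dilated_profile1_derive k t x : (1 <= k)%nat -> -1 < t < 1 ->
  is_derive (fun x => / INR k * profile1 t (INR k * x)) x (profile2 t (INR k * x)).
Proof.
  intros Hk Ht. assert (HK := INR_ge_1 k Hk).
  replace (profile2 t _) with (/ INR k * (INR k * profile2 t (INR k * x)))
    by (field; lra).
  now apply derive_dilation, profile1_derive.
Qed.

Lemma branch_derive k s x : (1 <= k)%nat -> 0 < s ->
  is_derive (branch k s) x (/ INR k * profile1 (amplitude s) (INR k * x)).
Proof.
  intros Hk Hs. apply dilated_profile_derive; [easy|].
  assert (h := amplitude_bounds s Hs). lra.
Qed.

(** Stated for a general filter, to serve both for continuity at [s > 0] and for the
convergence to zero at the bifurcation point. *)
Lemma branch_holder_converges alpha k t0 (F : (R -> Prop) -> Prop) {FF : Filter F} :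
  1 < alpha < 2 -> (1 <= k)%nat -> -1 < t0 < 1 -> filterlim amplitude F (locally t0) ->
  forall f, (forall x, f x = / INR k ^ 2 * profile t0 (INR k * x)) ->
  holder_converges alpha (branch k) F f.
Proof.
  intros Halpha Hk Ht Hamp f Hf eps. assert (HK := INR_ge_1 k Hk).
  assert (i1 := inv_pow_le_1 (INR k) 1 HK). assert (i2 := inv_pow_le_1 (INR k) 2 HK).
  rewrite pow_1 in i1.
  assert (e0 := cond_pos eps). assert (A0 : 0 < eps / 5) by lra.
  assert (Hev : forall P, locally t0 P -> F (fun s => P (amplitude s))) by exact Hamp.
  generalize (filter_and _ _ (Hev _ (locally_interior t0 Ht))
    (filter_and _ _ (Hev _ (profile_uniform t0 Ht _ A0))
      (filter_and _ _ (Hev _ (profile1_uniform t0 Ht _ A0))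
         (Hev _ (profile2_uniform t0 Ht _ A0))))).
  apply filter_imp. intros s [Hs [H0 [H1 H2]]].
  apply Rbar_le_lt_trans with (4 * (eps / 5)); [|simpl; lra].
  assert (Hscal : forall c d, 0 < c <= 1 -> Rabs d <= eps / 5 -> Rabs (c * d) <= eps / 5).
  { intros c d Hc Hd. rewrite Rabs_mult, (Rabs_pos_eq c) by lra.
    assert (h := Rabs_pos d). nra. }
  set (t := amplitude s) in *.
  apply (holder_norm_le alpha _
    (fun x => / INR k * profile1 t (INR k * x) - / INR k * profile1 t0 (INR k * x))
    (fun x => profile2 t (INR k * x) - profile2 t0 (INR k * x))); [easy|..].
  - intros x. apply (is_derive_minus (branch k s) f).
    + now apply dilated_profile_derive.
    + apply is_derive_ext with (fun x => / INR k ^ 2 * profile t0 (INR k * x)); [easy|].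
      now apply dilated_profile_derive.
  - intros x. apply (is_derive_minus (fun x => / INR k * profile1 t (INR k * x))
      (fun x => / INR k * profile1 t0 (INR k * x))); now apply dilated_profile1_derive.
  - intros x. rewrite Hf. unfold branch. fold t. rewrite <- Rmult_minus_distr_l.
    apply Hscal; [easy|]. now apply H0.
  - intros x. rewrite <- Rmult_minus_distr_l. apply Hscal; [easy|]. now apply H1.
  - intros x. now apply H2.
Qed.

Lemma wave_speed_pos t : -1 < t < 1 -> 0 < wave_speed t.
Proof.
  intros Ht. apply Rmult_lt_0_compat; [apply pow_lt; now apply scale_pos|].
  assert (h := pow2_ge_0 t). lra.
Qed.

Lemma profile_even t y : -1 < t < 1 -> profile t (- y) = profile t y.
Proof. intros Ht. unfold profile, elevation. now rewrite angle_odd, cos_neg. Qed.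

Lemma profile_periodic t : -1 < t < 1 -> periodic (2 * PI) (profile t).
Proof. intros Ht y. unfold profile, elevation. now rewrite angle_period, cos_periodic. Qed.

Lemma periodic_dilation (k : nat) (c : R) (f : R -> R) : (1 <= k)%nat -> periodic (2 * PI) f ->
  periodic (2 * PI / INR k) (fun x => c * f (INR k * x)).
Proof.
  intros Hk Hf x. assert (HK := INR_ge_1 k Hk).
  replace (INR k * (x + 2 * PI / INR k)) with (INR k * x + 2 * PI) by (field; lra).
  now rewrite Hf.
Qed.

Lemma periodic_dilation_2PI (k : nat) (c : R) (f : R -> R) : (1 <= k)%nat ->
  periodic (2 * PI) f ->
  periodic (2 * PI) (fun x => c * f (INR k * x)).
Proof.
  intros Hk Hf. assert (HK := INR_ge_1 k Hk).
  replace (2 * PI) with (INR k * (2 * PI / INR k)) by (field; lra).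
  now apply periodic_mult, periodic_dilation.
Qed.

Lemma branch_continuous k s x : (1 <= k)%nat -> 0 < s -> continuous (branch k s) x.
Proof.
  intros Hk Hs. apply (ex_derive_continuous (branch k s)). eexists.
  now apply branch_derive.
Qed.

Lemma branch_steady k s : (1 <= k)%nat -> 0 < s ->
  steady_solution (branch k s) (branch_speed k s).
Proof.
  intros Hk Hs. assert (HK := INR_ge_1 k Hk).
  assert (Ht : -1 < amplitude s < 1) by (assert (h := amplitude_bounds s Hs); lra).
  apply (classical_solution_steady _
    (fun x => / INR k ^ 3 * flux1 (amplitude s) (angle (amplitude s) (INR k * x)))).
  - apply Rmult_lt_0_compat; [now apply inv_pow_le_1|now apply wave_speed_pos].
  - apply periodic_dilation_2PI; [easy|]. now apply profile_periodic.
  - apply (periodic_dilation_2PI k (/ INR k ^ 3)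
      (fun y => flux1 (amplitude s) (angle (amplitude s) y)));
      [easy|].
    intros y. unfold flux1. now rewrite angle_period, sin_periodic, root_factor_periodic.
  - intros; now apply branch_continuous.
  - intros x.
    apply is_derive_ext with (fun x => / INR k ^ 4 *
      (/ 2 * profile (amplitude s) (INR k * x) ^ 2
       - wave_speed (amplitude s) * profile (amplitude s) (INR k * x))).
    { intros y. unfold branch, branch_speed. simpl. field. lra. }
    replace (/ INR k ^ 3 * _) with
      (/ INR k ^ 4 * (INR k * flux1 (amplitude s) (angle (amplitude s) (INR k * x))))
      by (field; lra).
    apply (derive_dilation (fun y => / 2 * profile (amplitude s) y ^ 2
       - wave_speed (amplitude s) * profile (amplitude s) y)).
    now apply flux_derive.
  - intros x. unfold branch.
    replace (/ INR k ^ 2 * _) with (/ INR k ^ 3 * (INR k * profile (amplitude s) (INR k * x)))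
      by (field; lra).
    apply (derive_dilation (fun y => flux1 (amplitude s) (angle (amplitude s) y))).
    now apply flux1_derive.
Qed.

Lemma branch_even k s : 0 < s -> even_function (branch k s).
Proof.
  intros Hs x. unfold branch. rewrite Ropp_mult_distr_r_reverse, profile_even; [easy|].
  assert (h := amplitude_bounds s Hs). lra.
Qed.

Lemma branch_smooth k s : 0 < s -> smooth (branch k s).
Proof.
  intros Hs.
  assert (Ht : -1 < amplitude s < 1) by (assert (h := amplitude_bounds s Hs); lra).
  apply (smooth_of_closed_family (fun f => exists c h, trig_profile (amplitude s) h /\
    forall x, f x = c * h (INR k * x))).
  - intros f [c [h [Hh Ef]]].
    destruct (trig_profile_derive _ h Ht Hh) as [dh [Pdh Hdh]].
    exists (fun x => (c * INR k) * dh (INR k * x)). split.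
    + now exists (c * INR k), dh.
    + intros x. apply is_derive_ext with (fun x => c * h (INR k * x)); [easy|].
      rewrite Rmult_assoc. apply derive_dilation, Hdh.
  - exists (/ INR k ^ 2), (profile (amplitude s)). split; [|easy].
    exists (elevation (amplitude s)). split; [apply elevation_trig|easy].
Qed.

Lemma branch_nontrivial k s : (1 <= k)%nat -> 0 < s -> branch k s 0 <> 0.
Proof.
  intros Hk Hs. assert (HK := INR_ge_1 k Hk). assert (Ha := amplitude_bounds s Hs).
  unfold branch, profile. set (t := amplitude s) in *.
  rewrite Rmult_0_r, angle_0 by lra.
  unfold elevation. rewrite cos_0.
  apply Rgt_not_eq, Rmult_lt_0_compat; [now apply inv_pow_le_1|].
  apply Rmult_lt_0_compat.
  - apply pow_lt, scale_pos. lra.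
  - assert (h := pow2_ge_0 t). lra.
Qed.

Lemma branch_holder_0even alpha k s : 1 < alpha < 2 -> (1 <= k)%nat -> 0 < s ->
  holder_0even alpha (branch k s).
Proof.
  intros Halpha Hk Hs. assert (HK := INR_ge_1 k Hk).
  assert (Ht : -1 < amplitude s < 1) by (assert (h := amplitude_bounds s Hs); lra).
  destruct (branch_steady k s Hk Hs) as [_ [Hper [Hmean _]]].
  split; [easy|]. split; [now apply branch_even|]. split; [easy|]. split.
  - intros x. eexists. now apply branch_derive.
  - set (t := amplitude s) in *.
    assert (Hb : forall h, trig_algebra t h -> exists B, forall y, Rabs (h (angle t y)) <= B).
    { intros h Hh. destruct (trig_algebra_bounded t h Ht Hh) as [B HB]. now exists B. }
    destruct (Hb _ (elevation_trig t)) as [B0 H0].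
    destruct (Hb _ (elevation1_trig t)) as [B1 H1].
    destruct (Hb _ (elevation2_trig t)) as [B2 H2].
    assert (p0 := Rle_trans _ _ _ (Rabs_pos _) (H0 0)).
    assert (p1 := Rle_trans _ _ _ (Rabs_pos _) (H1 0)).
    assert (p2 := Rle_trans _ _ _ (Rabs_pos _) (H2 0)).
    assert (Hscal : forall c d B, 0 < c <= 1 -> Rabs d <= B -> Rabs (c * d) <= B).
    { intros c d B Hc Hd. rewrite Rabs_mult, (Rabs_pos_eq c) by lra.
      assert (h := Rabs_pos d). nra. }
    assert (i1 := inv_pow_le_1 (INR k) 1 HK). rewrite pow_1 in i1.
    apply Rbar_le_lt_trans with (4 * (B0 + B1 + B2)); [|easy].
    apply (holder_norm_le alpha _ (fun x => / INR k * profile1 t (INR k * x))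
      (fun x => profile2 t (INR k * x))); [easy|..].
    + intros; now apply branch_derive.
    + intros; now apply dilated_profile1_derive.
    + intros x. apply Hscal; [now apply inv_pow_le_1|].
      specialize (H0 (INR k * x)). unfold profile. fold t. lra.
    + intros x. apply Hscal; [easy|].
      specialize (H1 (INR k * x)). unfold profile1. lra.
    + intros x. specialize (H2 (INR k * x)). unfold profile2. lra.
Qed.

(** At [t = 0] the function [position_rate] is constant equal to 1; this makes
[k^-2] the wave speed at the bifurcation point. *)
Lemma scale_0 : scale 0 = 1.
Proof.
  unfold scale, position. rewrite (RInt_ext (position_rate 0) (fun _ => 1)).
  - rewrite RInt_const. unfold scal; simpl; unfold mult; simpl.
    field. assert (h := PI_RGT_0). lra.
  - intros x _. unfold position_rate, depth, root_factor.
    replace (3 - 2 * 0 * cos x - 0 ^ 2) with 3 by ring.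
    assert (h := sqrt3_pos). change (sqrt 3 * (1 - 0 * cos x) / sqrt 3 = 1).
    field. lra.
Qed.

Lemma branch_speed_limit k (F : (R -> Prop) -> Prop) {FF : Filter F} t0 :
  -1 < t0 < 1 -> filterlim amplitude F (locally t0) ->
  filterlim (branch_speed k) F (locally (/ INR k ^ 2 * wave_speed t0)).
Proof.
  intros Ht Ha. apply filterlim_Rmult; [easy|apply filterlim_const|].
  apply (filterlim_comp _ _ _ amplitude wave_speed F (locally t0)); [easy|].
  apply (wave_speed_limit (locally t0)); [apply filterlim_id|now apply scale_continuous].
Qed.

Lemma branch_emerges alpha k : 1 < alpha < 2 -> (1 <= k)%nat ->
  branch_from_zero alpha (branch k) (branch_speed k) (/ INR k ^ 2).
Proof.
  intros Halpha Hk. split; [|split; [|split]].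
  - intros s Hs. split; [now apply branch_holder_0even|].
    destruct (branch_steady k s Hk Hs) as [h _]. exact h.
  - intros s Hs. assert (Ha := amplitude_bounds s Hs).
    assert (Hc := amplitude_continuous s (Rlt_le _ _ Hs)). split.
    + apply (branch_holder_converges alpha k (amplitude s) (locally s)); easy || lra.
    + apply (branch_speed_limit k (locally s) (amplitude s)); [lra|easy].
  - apply (branch_holder_converges alpha k 0 (at_right 0)); 
      [easy|easy|lra|apply amplitude_at_right_0|].
    intros x. unfold profile, elevation, Rdiv. ring.
  - replace (/ INR k ^ 2) with (/ INR k ^ 2 * wave_speed 0)
      by (unfold wave_speed; rewrite scale_0; field; apply not_0_INR; lia).
    apply (branch_speed_limit k (at_right 0) 0); [lra|apply amplitude_at_right_0].
Qed.

Lemma uniform_comp {S T} D (F : (S -> Prop) -> Prop) (G : (T -> Prop) -> Prop)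
    (tau : S -> T) f f0 :
  filterlim tau F G -> uniform_limit D G f f0 -> uniform_limit D F (fun s => f (tau s)) f0.
Proof. intros Ht H eps He. exact (Ht _ (H eps He)). Qed.

(** Infinitely many indices exceed any bound, as finitely many values are bounded;
so each index can be chosen beyond the previous one. *)
Lemma unbounded_subsequence (s : nat -> R) : (forall M, exists n, M < s n) ->
  exists sigma : nat -> nat, (forall n, (sigma n < sigma (S n))%nat) /\
    is_lim_seq (fun n => s (sigma n)) p_infty.
Proof.
  intros Hs.
  assert (Hbd : forall N, exists B, forall i, (i < N)%nat -> s i <= B).
  { induction N as [|N [B HB]].
    - exists 0. intros; lia.
    - exists (Rmax B (s N)). intros i Hi.
      destruct (PeanoNat.Nat.eq_dec i N) as [->|e]; [apply Rmax_r|].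
      eapply Rle_trans; [apply HB; lia|apply Rmax_l]. }
  assert (Hpick : forall (N : nat) M, exists n, (N <= n)%nat /\ M < s n).
  { intros N M. destruct (Hbd N) as [B HB]. destruct (Hs (Rmax B M)) as [n Hn].
    exists n. assert (h1 := Rmax_l B M). assert (h2 := Rmax_r B M). split; [|lra].
    destruct (Compare_dec.le_lt_dec N n) as [h|h]; [easy|]. specialize (HB n h). lra. }
  set (pick := fun N M => proj1_sig (constructive_indefinite_description _ (Hpick N M))).
  assert (Hp : forall N M, (N <= pick N M)%nat /\ M < s (pick N M)).
  { intros N M. exact (proj2_sig (constructive_indefinite_description _ (Hpick N M))). }
  set (sigma := fix sigma n := match n with
                  | O => pick O 0 | S m => pick (S (sigma m)) (INR (S m)) end).
  exists sigma. split.
  - intros n. apply (Hp (S (sigma n))).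
  - apply is_lim_seq_le_p_loc with (2 := is_lim_seq_INR). exists O. intros [|n] _.
    + left. apply (Hp O 0).
    + left. apply (Hp (S (sigma n))).
Qed.

(** * The limiting wave *)

Lemma corner_wave_at_0 k : (1 <= k)%nat -> corner_wave k 0 = / INR k ^ 2 * (PI ^ 2 / 9).
Proof.
  intros Hk. unfold corner_wave. rewrite Rmult_0_r, corner_profile_half_period.
  - f_equal. field.
  - assert (h := PI_RGT_0). lra.
Qed.

Lemma corner_wave_increasing k x y : (1 <= k)%nat ->
  - PI / INR k < x -> x < y -> y < 0 -> corner_wave k x < corner_wave k y.
Proof.
  intros Hk Hx Hxy Hy. assert (HK := INR_ge_1 k Hk).
  apply (Rmult_lt_compat_l (INR k)) in Hx; [|lra].
  replace (INR k * (- PI / INR k)) with (- PI) in Hx by (field; lra).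
  apply (Rmult_lt_compat_l (INR k)) in Hxy; [|lra].
  apply (Rmult_lt_compat_l (INR k)) in Hy; [|lra].
  rewrite Rmult_0_r in Hy.
  apply Rmult_lt_compat_l; [now apply inv_pow_le_1|].
  rewrite <- (corner_profile_even (INR k * x)), <- (corner_profile_even (INR k * y)).
  rewrite !corner_profile_half_period by lra. nra.
Qed.

Lemma periodic_IZR_mult (L : R) (f : R -> R) (m : Z) : periodic L f -> periodic (L * IZR m) f.
Proof.
  intros H x.
  destruct (Z.le_ge_cases 0 m) as [h|h].
  - rewrite <- (Z2Nat.id m h), <- INR_IZR_INZ, (Rmult_comm L). now apply periodic_mult.
  - rewrite <- (periodic_mult L f (Z.to_nat (- m)) H (x + L * IZR m)).
    rewrite INR_IZR_INZ, Z2Nat.id, opp_IZR by lia. f_equal. ring.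
Qed.

(** At distance [d <= PI / k] from a crest the wave is lower by
[d (2 PI - k d) / (6 k)], which lies between [PI d / (6 k)] and [PI d / (3 k)]. *)
Lemma corner_wave_exactly_Lipschitz k m : (1 <= k)%nat ->
  exactly_Lipschitz_at (corner_wave k) (2 * PI / INR k * IZR m).
Proof.
  intros Hk. assert (HK := INR_ge_1 k Hk). assert (hpi := PI_RGT_0).
  exists (PI / (6 * INR k)), (PI / (3 * INR k)), (PI / INR k).
  assert (d0 : 0 < PI / INR k) by (apply Rdiv_lt_0_compat; lra).
  assert (E6 : PI / (6 * INR k) = PI / INR k / 6) by (field; lra).
  assert (E3 : PI / (3 * INR k) = PI / INR k / 3) by (field; lra).
  split; [lra|]. split; [lra|]. split; [lra|].
  set (x0 := 2 * PI / INR k * IZR m). intros x Hx.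
  set (d := Rabs (x - x0)) in *.
  assert (Hd : 0 <= d) by apply Rabs_pos.
  assert (Hval : forall z, Rabs (z - x0) <= PI / INR k ->
    corner_wave k z = / INR k ^ 2 * ((PI - INR k * Rabs (z - x0)) ^ 2 / 6 - PI ^ 2 / 18)).
  { intros z Hz. unfold corner_wave. f_equal.
    replace (INR k * z) with (INR k * (z - x0) + 2 * PI * IZR m)
      by (unfold x0; field; lra).
    rewrite (periodic_IZR_mult (2 * PI) corner_profile m corner_profile_periodic).
    assert (Hz' : INR k * Rabs (z - x0) <= PI).
    { apply (Rmult_le_compat_l (INR k)) in Hz; [|lra].
      now replace (INR k * (PI / INR k)) with PI in Hz by (field; lra). }
    rewrite <- corner_profile_half_period.
    - unfold Rabs. destruct (Rcase_abs (z - x0)); [|easy].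
      rewrite <- corner_profile_even. f_equal. ring.
    - split; [|easy]. apply Rmult_le_pos; [lra|apply Rabs_pos]. }
  assert (Hkd : INR k * d < PI).
  { apply (Rmult_lt_compat_l (INR k)) in Hx; [|lra].
    now replace (INR k * (PI / INR k)) with PI in Hx by (field; lra). }
  rewrite (Hval x), (Hval x0) by (rewrite ?Rminus_diag, ?Rabs_R0; fold d; lra).
  rewrite Rminus_diag, Rabs_R0. fold d.
  replace (_ - _) with (d * (2 * PI - INR k * d) / (6 * INR k)) by (field; lra).
  rewrite Rabs_pos_eq.
  - split.
    + replace (PI / (6 * INR k) * d) with (d * PI / (6 * INR k)) by (field; lra).
      apply Rmult_le_compat_r; [left; apply Rinv_0_lt_compat; lra|].
      apply Rmult_le_compat_l; lra.
    + replace (PI / (3 * INR k) * d) with (d * (2 * PI) / (6 * INR k)) by (field; lra).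
      apply Rmult_le_compat_r; [left; apply Rinv_0_lt_compat; lra|].
      apply Rmult_le_compat_l; [lra|].
      assert (0 <= INR k * d) by (apply Rmult_le_pos; lra). lra.
  - apply Rdiv_le_0_compat; [apply Rmult_le_pos; lra|lra].
Qed.

Lemma corner_wave_bounded k x : (1 <= k)%nat -> Rabs (corner_wave k x) <= PI ^ 2.
Proof.
  intros Hk. assert (i2 := inv_pow_le_1 (INR k) 2 (INR_ge_1 k Hk)).
  assert (h : Rabs (corner_profile (INR k * x)) <= PI ^ 2).
  { unfold corner_profile. assert (h := acos_bound (cos (INR k * x))).
    apply Rabs_le. nra. }
  unfold corner_wave. rewrite Rabs_mult, (Rabs_pos_eq (/ _)) by lra.
  assert (p := Rabs_pos (corner_profile (INR k * x))). nra.
Qed.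

(** Along any sequence going to infinity the whole branch converges, because its end
[t -> 1] has a single limit point. *)
Lemma branch_uniform_limit k (s : nat -> R) : (1 <= k)%nat -> is_lim_seq s p_infty ->
  uniform_limit (fun _ => True) eventually (fun n => branch k (s n)) (corner_wave k) /\
  is_lim_seq (fun n => branch_speed k (s n)) (/ INR k ^ 2 * (PI ^ 2 / 9)).
Proof.
  intros Hk Hs.
  assert (i2 := inv_pow_le_1 (INR k) 2 (INR_ge_1 k Hk)).
  assert (Hamp : filterlim (fun n => amplitude (s n)) eventually (at_left 1))
    by (apply (filterlim_comp _ _ _ s amplitude _ _ _ Hs), amplitude_at_infinity).
  split.
  - intros eps He.
    generalize (uniform_comp _ _ _ _ _ _ Hamp profile_uniform_1 eps He). apply filter_imp.
    intros n Hn x _. unfold branch, corner_wave.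
    rewrite <- Rmult_minus_distr_l, Rabs_mult, (Rabs_pos_eq (/ _)) by lra.
    specialize (Hn (INR k * x) I).
    assert (p := Rabs_pos (profile (amplitude (s n)) (INR k * x) - corner_profile (INR k * x))).
    nra.
  - apply (filterlim_Rmult eventually (fun _ => / INR k ^ 2)); [apply filterlim_const|].
    apply (filterlim_comp _ _ _ (fun n => amplitude (s n)) wave_speed _ _ _
             Hamp wave_speed_limit_1).
Qed.

Theorem corollary6p2 :
  forall (alpha : R), 1 < alpha < 2 ->
  forall (k : nat), (1 <= k)%nat ->
  exists (phi : R -> R -> R) (mu : R -> R),
    branch_from_zero alpha phi mu (/ INR k ^ 2) /\
    (forall s : R, 0 < s ->
       steady_solution (phi s) (mu s) /\
       (exists x, phi s x <> 0) /\
       periodic (2 * PI / INR k) (phi s) /\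
       smooth (phi s) /\
       even_function (phi s)) /\
    (forall s : nat -> R,
       (forall n, 0 < s n) ->
       (forall M : R, exists n, M < s n) ->
       exists (sigma : nat -> nat) (phibar : R -> R) (mubar : R),
         (forall n, (sigma n < sigma (S n))%nat) /\
         converges_uniformly (fun n => phi (s (sigma n))) phibar /\
         is_lim_seq (fun n => mu (s (sigma n))) mubar /\
         steady_solution phibar mubar /\
         phibar 0 = mubar /\
         (forall x y : R, - PI / INR k < x -> x < y -> y < 0 ->
            phibar x < phibar y) /\
         (forall m : Z,
            exactly_Lipschitz_at phibar (2 * PI / INR k * IZR m))).
Proof.
  intros alpha Halpha k Hk. exists (branch k), (branch_speed k).
  split; [now apply branch_emerges|]. split.
  - intros s Hs. split; [now apply branch_steady|].
    split; [exists 0; now apply branch_nontrivial|].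
    split; [|split; [now apply branch_smooth|now apply branch_even]].
    apply periodic_dilation; [easy|]. apply profile_periodic.
    assert (h := amplitude_bounds s Hs). lra.
  - intros s Hpos Hs.
    destruct (unbounded_subsequence s Hs) as [sigma [Hsigma Hlim]].
    destruct (branch_uniform_limit k (fun n => s (sigma n)) Hk Hlim) as [Hphi Hmu].
    exists sigma, (corner_wave k), (/ INR k ^ 2 * (PI ^ 2 / 9)).
    split; [easy|]. split; [now apply converges_uniformly_iff|]. split; [easy|].
    split; [|split; [now apply corner_wave_at_0|split]].
    + apply (steady_solution_limit (fun n => branch k (s (sigma n))) _
        (fun n => branch_speed k (s (sigma n))) _ (PI ^ 2)); [| |easy|easy| |].
      * intros n. now apply branch_steady.
      * intros n x. now apply branch_continuous.
      * apply Rmult_lt_0_compat; [now apply inv_pow_le_1, INR_ge_1|].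
        assert (h := pow_lt PI 2 PI_RGT_0). lra.
      * intros x. now apply corner_wave_bounded.
    + intros x y. now apply corner_wave_increasing.
    + intros m. now apply corner_wave_exactly_Lipschitz.
Qed.
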